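(* Let $n, n_u, n_v \in \mathbb{N}$, $\alpha \in (0,1)$, $T>0$, let $P \subset \mathbb{R}^{n_u}$ and $Q \subset \mathbb{R}^{n_v}$ be compact sets, and let $g: [0,T] \times \mathbb{R}^n \times P \times Q \to \mathbb{R}^n$ satisfy the following conditions: (g.1) $g$ is continuous. (g.2) For any $r \geqslant 0$, there exists $\lambda_g > 0$ such that $\|g(t,x,u,v) - g(t,y,u,v)\| \leqslant \lambda_g \|x-y\|$ for all $t \in [0,T]$, $x,y \in B(r)$, $u \in P$, $v \in Q$. (g.3) There exists $c_g > 0$ such that $\|g(t,x,u,v)\| \leqslant (1+\|x\|) c_g$ for all $t \in [0,T]$, $x \in \mathbb{R}^n$, $u \in P$, $v \in Q$. (g.4) For any $t \in [0,T]$ and $x, s \in \mathbb{R}^n$, $\min_{u \in P} \max_{v \in Q} \langle s, g(t,x,u,v)\rangle = \max_{v \in Q} \min_{u \in P} \langle s, g(t,x,u,v) \rangle$. Then, for any $R_0 > 0$ and $\varepsilon > 0$, there exist $K > 0$ and $\delta > 0$ such that, for any initial values $x_0, y_0 \in B(R_0)$, any partition $\Delta$ of $[0,T]$ with diameter $\operatorname{diam}(\Delta) \leqslant \delta$ and any realizations $v(\cdot) \in \mathcal{V}$, $\widetilde{u}(\cdot) \in \mathcal{U}$, if realizations $u(\cdot) \in \mathcal{U}$, $\widetilde{v}(\cdot) \in \mathcal{V}$ are formed according to the mutual aiming procedure on $\Delta$ (defined in the context), then the corresponding motions $x(\cdot) = x(\cdot; x_0, u(\cdot), v(\cdot))$ of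 the system and $y(\cdot) = x(\cdot; y_0, \widetilde{u}(\cdot), \widetilde{v}(\cdot))$ of the guide satisfy $$\|x(\cdot) - y(\cdot)\|_\infty \leqslant \varepsilon + K \|x_0 - y_0\|.$$
   Context: $\mathbb{R}^n$ is Euclidean space with scalar product $\langle\cdot,\cdot\rangle$ and norm $\|\cdot\|$; $B(r) \subset \mathbb{R}^n$ is the closed ball of radius $r$ centered at the origin; $[0,T]$ carries the Lebesgue measure; $\|\cdot\|_\infty$ is the (essential) supremum norm on $[0,T]$. $L^\infty([0,T],\mathbb{R}^n)$ is the space of essentially bounded measurable functions. Riemann-Liouville fractional integral: $(I^\alpha \varphi)(t) = \frac{1}{\Gamma(\alpha)} \int_0^t \frac{\varphi(\tau)}{(t-\tau)^{1-\alpha}} d\tau$, $t\in[0,T]$; $I^\alpha(L^\infty([0,T],\mathbb{R}^n))$ is the set of functions $x:[0,T]\to\mathbb{R}^n$ with $x(t) = (I^\alpha\varphi)(t)$ for all $t\in[0,T]$, for some $\varphi(\cdot) \in L^\infty([0,T],\mathbb{R}^n)$. Caputo derivative: $({}^C D^\alpha x)(t) = \frac{1}{\Gamma(1-\alpha)} \frac{d}{dt} \int_0^t \frac{x(\tau) - x(0)}{(t-\tau)^\alpha} d\tau$. Admissible realizations: $\mathcal{U}$ is the set of all measurable functions $[0,T) \to P$, and $\mathcal{V}$ is the set of all measurable functions $[0,T) \to Q$. Motions: for $z_0 \in \mathbb{R}^n$, $u(\cdot) \in \mathcal{U}$, $v(\cdot) \in \mathcal{V}$, the motion $x(\cdot;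 z_0, u(\cdot), v(\cdot))$ is the (existing and unique) function $z(\cdot) \in \{z_0\} + I^\alpha(L^\infty([0,T],\mathbb{R}^n))$ (i.e. $z(\cdot) - z_0 \in I^\alpha(L^\infty([0,T],\mathbb{R}^n))$) such that $({}^C D^\alpha z)(t) = g(t, z(t), u(t), v(t))$ for almost every $t \in [0,T]$. The system has motion $x(\cdot) = x(\cdot; x_0, u(\cdot), v(\cdot))$; the guide is a copy of the system, governed by the same equation, with initial value $y_0$, realizations $\widetilde{u}(\cdot) \in \mathcal{U}$, $\widetilde{v}(\cdot) \in \mathcal{V}$ and motion $y(\cdot) = x(\cdot; y_0, \widetilde{u}(\cdot), \widetilde{v}(\cdot))$. Partition: $\Delta = \{\tau_j\}_{j=1}^{k+1} \subset [0,T]$ with $k \in \mathbb{N}$, $\tau_1 = 0$, $\tau_{j+1} > \tau_j$ for $j = 1,\dots,k$, $\tau_{k+1} = T$; $\operatorname{diam}(\Delta) = \max_{1 \leqslant j \leqslant k} (\tau_{j+1} - \tau_j)$. Mutual aiming procedure on $\Delta$: set $s(t) = x(t) - y(t)$. The realizations $u(\cdot)$ and $\widetilde{v}(\cdot)$ are formed step by step: for each $j = 1,\dots,k$, once the values $x(\tau_j), y(\tau_j)$ have been realized, one puts, for all $t \in [\tau_j, \tau_{j+1})$, $$u(t) = u_j \in \operatorname{argmin}_{u \in P} \max_{v \in Q} \langle s(\tau_j), g(\tau_j, x(\tau_j), u, v) \rangle, \qquad \widetilde{v}(t) = \widetilde{v}_j \in \operatorname{argmax}_{\widetilde{v} \in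 Q} \min_{\widetilde{u} \in P} \langle s(\tau_j), g(\tau_j, x(\tau_j), \widetilde{u}, \widetilde{v}) \rangle,$$ where $u_j$, $\widetilde{v}_j$ are arbitrary elements of the respective sets. (Values of a motion at $\tau_j$ depend only on the realizations on $[0,\tau_j)$.) *)

(* Defs.v *)
From HB Require Import structures.
From mathcomp Require Import all_boot all_order all_algebra.
From mathcomp Require Import all_classical all_reals all_analysis.

Set Implicit Arguments.
Unset Strict Implicit.
Unset Printing Implicit Defensive.
Import Order.TTheory GRing.Theory Num.Theory.
Import numFieldNormedType.Exports.
Local Open Scope classical_set_scope.
Local Open Scope ring_scope.

(* R^n is 'rV[R]_n. The library norm `|x| on 'rV[R]_n is the maximum norm, so
   the Euclidean norm is defined separately; both induce the same topology,
   which is the one used for continuity, compactness and derivatives. *)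
Definition dotv (R : realType) (n : nat) (x y : 'rV[R]_n) : R :=
  \sum_(i < n) x 0 i * y 0 i.

Definition enorm (R : realType) (n : nat) (x : 'rV[R]_n) : R :=
  Num.sqrt (dotv x x).

Definition cball0 (R : realType) (n : nat) (r : R) : set 'rV[R]_n :=
  [set x | enorm x <= r].

(* The minimum and maximum of f over A. They are attained when A is nonempty
   and compact and f is continuous on A; the value is 0 if they do not exist. *)
Definition minval (R : realType) (X : Type) (A : set X) (f : X -> R) : R :=
  xget 0 (f @` A `&` lbound (f @` A)).

Definition maxval (R : realType) (X : Type) (A : set X) (f : X -> R) : R :=
  xget 0 (f @` A `&` ubound (f @` A)).

Definition argmin (R : realType) (X : Type) (A : set X) (f : X -> R) : set X :=
  [set a | A a /\ forall b, A b -> f a <= f b].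

Definition argmax (R : realType) (X : Type) (A : set X) (f : X -> R) : set X :=
  [set a | A a /\ forall b, A b -> f b <= f a].

(* R with the sigma-algebra of Lebesgue measurable sets (the canonical
   measurable structure on R itself is the Borel one). *)
Notation lebesgueType R :=
  (caratheodory_type ((@wlength R idfun)^*)%mu).

Notation lebesgue R :=
  (@completed_lebesgue_measure R).

(* The measurable sets of the codomain are the Borel sets of R^m. *)
Definition lebesgue_measurable_fun (R : realType) (m : nat) (D : set R)
    (f : R -> 'rV[R]_m) : Prop :=
  measurable_fun (D : set (lebesgueType R))
    (f : lebesgueType R -> g_sigma_algebraType (@open 'rV[R]_m)).

(* Functions on [0, T] or [0, T[ are represented by functions on R whose values
   outside the interval are irrelevant. *)
Definition realizations (R : realType) (m : nat) (T : R) (A : set 'rV[R]_m) :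
    set (R -> 'rV[R]_m) :=
  [set u | lebesgue_measurable_fun `[0, T[ u /\
           forall t, 0 <= t < T -> A (u t)].

Definition Linf_norm (R : realType) (n : nat) (T : R) (f : R -> 'rV[R]_n) :
    \bar R :=
  Lnorm (lebesgue R) +oo%E
    (EFin \o ((fun t : R => enorm (f t)) \_ `[0, T])).

Definition Linf (R : realType) (n : nat) (T : R) : set (R -> 'rV[R]_n) :=
  [set f | lebesgue_measurable_fun `[0, T] f /\ (Linf_norm T f < +oo)%E].

Definition Gamma (R : realType) (a : R) : R :=
  \int[lebesgue R]_(t in `]0, +oo[) (t `^ (a - 1) * expR (- t)).

Definition RL_integral (R : realType) (n : nat) (alpha : R)
    (phi : R -> 'rV[R]_n) (t : R) : 'rV[R]_n :=
  (Gamma alpha)^-1 *: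
    \row_i \int[lebesgue R]_(tau in `[0, t])
      (phi tau 0 i / (t - tau) `^ (1 - alpha)).

Definition RL_range (R : realType) (n : nat) (alpha T : R) :
    set (R -> 'rV[R]_n) :=
  [set x | exists2 phi, @Linf R n T phi &
     forall t, 0 <= t <= T -> x t = RL_integral alpha phi t].

Definition Caputo_integral (R : realType) (n : nat) (alpha : R)
    (x : R -> 'rV[R]_n) (t : R) : 'rV[R]_n :=
  \row_i \int[lebesgue R]_(tau in `[0, t])
    ((x tau - x 0) 0 i / (t - tau) `^ alpha).

Definition Caputo (R : realType) (n : nat) (alpha : R) (x : R -> 'rV[R]_n)
    (t : R) : 'rV[R]_n :=
  (Gamma (1 - alpha))^-1 *: derive1 (Caputo_integral alpha x) t.

(* derive1 is total, hence the explicit derivability. *)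
Definition is_motion (R : realType) (n nu nv : nat) (alpha T : R)
    (g : R -> 'rV[R]_n -> 'rV[R]_nu -> 'rV[R]_nv -> 'rV[R]_n)
    (z0 : 'rV[R]_n) (u : R -> 'rV[R]_nu) (v : R -> 'rV[R]_nv)
    (z : R -> 'rV[R]_n) : Prop :=
  @RL_range R n alpha T (fun t => z t - z0) /\
  {ae lebesgue R, forall t : R, 0 <= t <= T ->
    derivable (Caputo_integral alpha z) t 1 /\
    Caputo alpha z t = g t (z t) (u t) (v t)}.

(* The points tau_1 < ... < tau_(k+1) of a partition are numbered from 0 to k
   here; the values of tau beyond k are irrelevant. *)
Definition is_partition (R : realType) (T : R) (k : nat) (tau : nat -> R) :
    Prop :=
  [/\ (0 < k)%N, tau 0%N = 0,
      forall j, (j < k)%N -> tau j < tau j.+1 & tau k = T].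

Definition diam (R : realType) (k : nat) (tau : nat -> R) : R :=
  \big[Num.max/0]_(j < k) (tau j.+1 - tau j).

Definition mutual_aiming (R : realType) (n nu nv : nat)
    (P : set 'rV[R]_nu) (Q : set 'rV[R]_nv)
    (g : R -> 'rV[R]_n -> 'rV[R]_nu -> 'rV[R]_nv -> 'rV[R]_n)
    (k : nat) (tau : nat -> R) (x y : R -> 'rV[R]_n)
    (u : R -> 'rV[R]_nu) (vt : R -> 'rV[R]_nv) : Prop :=
  forall j, (j < k)%N ->
    let h u' v' :=
      dotv (x (tau j) - y (tau j)) (g (tau j) (x (tau j)) u' v') in
    exists uj vj,
      [/\ argmin P (fun u' => maxval Q (fun v' => h u' v')) uj,
          argmax Q (fun v' => minval P (fun u' => h u' v')) vj &
          forall t, tau j <= t < tau j.+1 -> u t = uj /\ vt t = vj].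

(* Main.v *)
Require Import Defs.
From HB Require Import structures.
From mathcomp Require Import all_boot all_order all_algebra.
From mathcomp Require Import all_classical all_reals all_analysis.
From mathcomp Require Import measurable_realfun ess_sup_inf ring lra.
Import Order.TTheory GRing.Theory Num.Theory.
Import numFieldNormedType.Exports.
Local Open Scope classical_set_scope.
Local Open Scope ring_scope.

(** Write s = x - y and let F be the difference of the two velocities, so that
    s has Caputo derivative F.

    Aiming makes <s, F> almost nonpositive. At a node tau_j the saddle point
    condition gives
      <s(tau_j), g(tau_j, x(tau_j), u_j, v) - g(tau_j, x(tau_j), u', v_j)> <= 0
    for all u' and v. The motions are Hoelder continuous with constants that
    depend on R0 alone, so uniform continuity of g carries this to the whole step
    [tau_j, tau_(j+1)[ up to an error that vanishes with the diameter, and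
    replacing x by y in the second velocity costs lam |s|^2 by the Lipschitz
    condition. Hence <s, F> <= lam |s|^2 + e' ([aiming_estimate]).

    For an ordinary differential equation one would now use (|s|^2)' = 2 <s, s'>.
    The fractional substitute is
      |s(t)|^2 <= |s(0)|^2 + 2 I^alpha <s, F>(t)
    ([sqr_J_le] for scalars, [traj_lyapunov] for vectors). A Gronwall lemma for
    the singular kernel ([fractional_gronwall]) then yields
    |s|^2 <= C (|s(0)|^2 + e'), which is the claim with K = sqrt C and
    e' = eps^2 / C. The same two facts, applied to a single motion instead of the
    difference of two, give the a priori bound ([motion_bounded]) from which the
    Lipschitz and Hoelder constants are taken.

    The scalar inequality w^2 <= 2 I^alpha (w f) for w = I^alpha f has to hold for
    f merely bounded and measurable, when w is only Hoelder continuous of order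
    alpha. It is proved without differentiating w. Put k(r) = r^(alpha - 1) and
    l(r) = r^(-alpha), with convolution on the half line. As l is nonincreasing
    and 2 w(t) w(r) = w(t)^2 + w(r)^2 - (w(t) - w(r))^2, the increment over
    [t - e, t] of l * w^2 is at most 2 w(t) times that of l * w, up to
    O(e^(1 + alpha)). Now l * w = l * k * f is a constant multiple of the primitive
    of f; hence, for a suitable constant b, the increments over [t - e, t] of
    D = 2 b int (w f) - l * w^2 are bounded below by -O(e^(1 + alpha)), and cutting
    an interval into many small pieces shows that D is nondecreasing. Convolution
    with the positive kernel k preserves this, and k * D is b times the primitive
    of 2 k * (w f) - w^2. So this continuous function is nonnegative.

    What ties the abstract statement to this calculus is [motion_traj]: a motion
    solves a Volterra equation z = z0 + c (k * f) with f equal to the velocity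
    almost everywhere. It rests on l * k * f = b int f, again, and on the Lebesgue
    differentiation theorem. *)

Set Implicit Arguments.
Unset Strict Implicit.
Unset Printing Implicit Defensive.

(** * Affine substitution and the integral of a power *)

Section affine.
Context {R : realType}.
Notation mu := (@lebesgue_measure R).

Lemma measurable_affine (c d : R) :
  measurable_fun setT (fun x : R => c * x + d).
Proof. by apply: measurable_funD => //; apply: measurable_funM. Qed.

(** Both sides are measures in [A], and they agree on bounded intervals. *)
Lemma lebesgue_measure_affine (c d : R) (A : set R) : c != 0 -> measurable A ->
  (mu A = `|c|%:E * mu ((fun x : R => (c * x + d)%R) @^-1` A))%E.
Proof.
move=> c0 mA.
have cpos : 0 <= `|c| by [].
pose phi := (fun x : R => c * x + d) : measurableTypeR R -> measurableTypeR R.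
have mphi : measurable_fun setT phi by exact: measurable_affine.
pose M := measure_function_pushforward__canonical__measure_function_Measure mu mphi.
transitivity (mscale (NngNum cpos) M A); last by [].
apply: (@lebesgue_measure_unique R (mscale (NngNum cpos) M)) => // _ [[a b]] _ <-.
rewrite lebesgue_measure_itv/= -[RHS]/(`|c|%:E * mu (phi @^-1` `]a, b]))%E.
have [cp|cn] := ltP 0 c.
  have -> : phi @^-1` `]a, b] = `](a - d) / c, (b - d) / c]%classic.
    apply/seteqP; split => x /=; rewrite !in_itv/= /phi ltr_pdivrMr// ler_pdivlMr//.
      by move=> /andP[? ?]; apply/andP; split; lra.
    by move=> /andP[? ?]; apply/andP; split; lra.
  rewrite lebesgue_measure_itv/= !lte_fin ltr_pM2r ?invr_gt0// ltrD2r.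
  case: ifPn => _; last by rewrite mule0.
  by rewrite -!EFinD -EFinM gtr0_norm//; congr _%:E; field; lra.
have {cn}cn : c < 0 by rewrite lt_neqAle c0.
have -> : phi @^-1` `]a, b] = `[(b - d) / c, (a - d) / c[%classic.
  apply/seteqP; split => x /=; rewrite !in_itv/= /phi ler_ndivrMr// ltr_ndivlMr//.
    by move=> /andP[? ?]; apply/andP; split; lra.
  by move=> /andP[? ?]; apply/andP; split; lra.
rewrite lebesgue_measure_itv/= !lte_fin ltr_nM2r ?invr_lt0// ltrD2r.
case: ifPn => _; last by rewrite mule0.
by rewrite -!EFinD -EFinM ltr0_norm//; congr _%:E; field; lra.
Qed.

Lemma ge0_integral_affine (c d : R) (f : R -> \bar R) : c != 0 ->
  measurable_fun setT f -> (forall x, 0 <= f x)%E ->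
  (\int[mu]_x f x = `|c|%:E * \int[mu]_x f (c * x + d)%R)%E.
Proof.
move=> c0 mf f0.
have cpos : 0 <= `|c| by [].
pose phi := (fun x : R => c * x + d) : measurableTypeR R -> measurableTypeR R.
have mphi : measurable_fun setT phi by exact: measurable_affine.
pose M := measure_function_pushforward__canonical__measure_function_Measure mu mphi.
transitivity (\int[mscale (NngNum cpos) M]_x f x)%E.
  by apply: eq_measure_integral => //= A mA _; exact: lebesgue_measure_affine.
rewrite ge0_integral_mscale//=.
by rewrite ge0_integral_pushforward.
Qed.

Lemma Rintegral_reflect (d : R) (f : R -> R) : measurable_fun setT f ->
  \int[mu]_x f x = \int[mu]_x f (d - x).
Proof.
move=> mf; rewrite /Rintegral; congr fine.
rewrite integralE [RHS]integralE.
have c0 : (-1 : R) != 0 by rewrite oppr_eq0 oner_eq0.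
rewrite (ge0_integral_affine d c0)//; last exact/measurable_funepos/measurable_EFinP.
rewrite (ge0_integral_affine d c0 (f := (EFin \o f)^\-%E))//; last exact/measurable_funeneg/measurable_EFinP.
rewrite normrN1 !mul1e; congr (_ - _)%E; apply: eq_integral => x _;
  by rewrite ?funeposE ?funenegE /= mulN1r addrC.
Qed.

(** The integrand is unbounded at 0; the integral is the limit of those over
    the compact intervals [x / (n + 2), x], where the fundamental theorem of
    calculus applies. *)
Lemma integral_powR (p x : R) : 0 < p -> 0 <= x ->
  (\int[mu]_(r in `]0%R, x]) (r `^ (p - 1))%:E = (x `^ p / p)%:E)%E.
Proof.
move=> p0; rewrite le_eqVlt => /predU1P[<-|x0].
  by rewrite set_itvoc0 integral_set0 powR0 ?gt_eqF// mul0r.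
pose a (n : nat) := x / n.+2%:R.
have a0 n : 0 < a n by rewrite divr_gt0.
have ax n : a n < x by rewrite ltr_pdivrMr// ltr_pMr// ltr1n.
pose F n := `[a n, x]%classic.
have UF : \bigcup_n F n = `]0, x]%classic.
  apply/seteqP; split=> [r [n _]|r]; rewrite /F /= !in_itv/= => /andP[r0 rx].
    by rewrite rx andbT (lt_le_trans (a0 n)).
  have xr : 0 < x / r by rewrite divr_gt0.
  exists (Num.truncn (x / r)) => //=; rewrite in_itv/= rx andbT.
  rewrite /a ler_pdivrMr// mulrC -ler_pdivrMr//.
  rewrite (le_trans (ltW (truncnS_gt _)))// ler_nat//.
have mF n : measurable (F n) by exact: measurable_itv.
have mp n : measurable_fun (F n) (fun r : R => (r `^ (p - 1))%:E).
  by apply/measurable_EFinP/measurable_funTS; exact: measurable_powR.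
have := @ge0_nondecreasing_set_cvg_integral _ (measurableTypeR R) _ F
  (fun r : R => (r `^ (p - 1))%:E) mu.
rewrite UF => H.
apply: (cvg_unique _ (H _ mF mp _)) => //.
- move=> m n mn; apply/subsetPset => r; rewrite /F /= !in_itv/= => /andP[r0 ->].
  rewrite andbT (le_trans _ r0)// /a ler_pM2l// lef_pV2 ?posrE//.
  by rewrite ler_nat.
- by move=> n r _; rewrite lee_fin powR_ge0.
have FE n : (\int[mu]_(r in F n) (r `^ (p - 1))%:E)%E =
    (x `^ p / p - a n `^ p / p)%:E.
  rewrite EFinB.
  apply: (@continuous_FTC2 _ _ (fun r => r `^ p / p)) => //.
  - apply: derivable_within_continuous => r /[!in_itv]/= /andP[r0 _].
    by apply: derivable_powR; rewrite in_itv/= andbT (lt_le_trans (a0 n)).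
  - have D r : 0 < r -> derivable (fun r => r `^ p / p) r 1.
      move=> r0; apply: derivableM => //.
      by apply: derivable_powR; rewrite in_itv/= andbT.
    have C r : 0 < r -> {for r, continuous (fun r => r `^ p / p)}.
      by move=> r0; apply: differentiable_continuous; apply/derivable1_diffP/D.
    split.
    + by move=> r /[!in_itv]/= /andP[r0 _]; apply: D; rewrite (lt_trans (a0 n)).
    + by apply: cvg_at_right_filter; apply: C.
    + by apply: cvg_at_left_filter; apply: C.
  - move=> r /[!in_itv]/= /andP[r0 _].
    have rp : 0 < r by rewrite (lt_trans (a0 n)).
    rewrite derive1E deriveM//; last by apply: derivable_powR; rewrite in_itv/= andbT.
    rewrite derive_cst scaler0 add0r -derive1E powR_derive1 ?in_itv/= ?andbT//.
    by rewrite /GRing.scale/= mulrA mulVf ?mul1r// gt_eqF.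
rewrite /= [X in X @ \oo](_ : _ = fun n => (x `^ p / p - a n `^ p / p)%:E); last first.
  by apply/funext => n; exact: FE.
apply: cvg_EFin; first exact: nearW.
rewrite -[X in _ --> X]subr0; apply: cvgB; first exact: cvg_cst.
rewrite -(mul0r p^-1); apply: cvgM; last exact: cvg_cst.
have /cvg_at_rightP H0 := powR_cvg0 p0.
apply: H0; split=> //.
rewrite -(mulr0 x); apply: cvgM; first exact: cvg_cst.
exact: (cvg_comp _ _ (cvg_addnl 1) (@cvg_harmonic R)).
Qed.

End affine.

(** * Unnormalized Riemann-Liouville integrals *)

Definition ker (R : realType) (p r : R) : R := if 0 < r then r `^ (p - 1) else 0.

(** The Riemann-Liouville integral of order [p] without the factor 1 / Gamma(p).
    Its kernel vanishes on the nonpositive half line, so that, for [f] vanishing on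
    the negative half line, integrating over R amounts to integrating over [0, t].
    Locking keeps unification from comparing integrals by unfolding them. *)
HB.lock Definition J (R : realType) (p : R) (f : R -> R) (t : R) : R :=
  \int[@lebesgue_measure R]_s (ker p (t - s) * f s).

Section riemann_liouville.
Context {R : realType}.
Notation mu := (@lebesgue_measure R).
Implicit Types (p q t s r a b m : R) (f g h : R -> R).

Lemma JE p f t : J p f t = \int[mu]_s (ker p (t - s) * f s).
Proof. by rewrite J.unlock. Qed.

Definition causal f := [/\ measurable_fun setT f, forall s, s < 0 -> f s = 0 &
  forall t, exists M : R, forall s, s <= t -> `|f s| <= M].

Definition chi a : R -> R := \1_(`[a, +oo[%classic).

Lemma chiE a s : chi a s = (a <= s)%R%:R.
Proof. by rewrite /chi indicE mem_setE in_itv/= andbT. Qed.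

Lemma ker_ge0 p r : 0 <= ker p r.
Proof. by rewrite /ker; case: ifP => // _; exact: powR_ge0. Qed.

Lemma ker_le0 p r : r <= 0 -> ker p r = 0.
Proof. by rewrite /ker ltNge => ->. Qed.

Lemma kerE p r : 0 < r -> ker p r = r `^ (p - 1).
Proof. by rewrite /ker => ->. Qed.

Lemma ker_nonincreasing p r s : p <= 1 -> 0 < r -> r <= s -> ker p s <= ker p r.
Proof.
move=> p1 r0 rs; rewrite !kerE ?(lt_le_trans r0)//.
have -> : p - 1 = - (1 - p) by rewrite opprB.
rewrite !powRN lef_pV2 ?posrE ?powR_gt0 ?(lt_le_trans r0)//.
by rewrite ge0_ler_powR ?nnegrE ?subr_ge0 ?(ltW r0)// (le_trans (ltW r0)).
Qed.

Lemma measurable_ker p : measurable_fun setT (ker p).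
Proof.
rewrite (_ : ker p = fun r => \1_(`]0, +oo[%classic) r * r `^ (p - 1)).
  by apply: measurable_funM => //; exact: measurable_powR.
apply/funext => r; rewrite /ker indicE mem_setE in_itv/= andbT.
by case: ifP; rewrite ?mul1r ?mul0r.
Qed.

Lemma measurable_ker_sub p t : measurable_fun setT (fun s => ker p (t - s)).
Proof.
apply: measurableT_comp; first exact: measurable_ker.
by apply: measurable_funB.
Qed.

Lemma causal_chi : causal (chi 0).
Proof.
split=> [|s s0|t]; first exact: measurable_indic.
  by rewrite chiE leNgt s0.
by exists 1 => s _; rewrite chiE; case: (0 <= s); rewrite ?normr1 ?normr0.
Qed.

Lemma causalD f g : causal f -> causal g -> causal (fun s => f s + g s).
Proof.
move=> [mf f0 bf] [mg g0 bg]; split=> [|s s0|t]; first exact: measurable_funD.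
  by rewrite f0// g0// addr0.
have [M HM] := bf t; have [N HN] := bg t; exists (M + N) => s st.
by rewrite (le_trans (ler_normD _ _))// lerD// ?HM ?HN.
Qed.

Lemma causalM f g : causal f -> causal g -> causal (fun s => f s * g s).
Proof.
move=> [mf f0 bf] [mg g0 bg]; split=> [|s s0|t]; first exact: measurable_funM.
  by rewrite f0// mul0r.
have [M HM] := bf t; have [N HN] := bg t; exists (M * N) => s st.
by rewrite normrM ler_pM// ?HM ?HN.
Qed.

Lemma causalZ a f : causal f -> causal (fun s => a * f s).
Proof.
move=> [mf f0 bf]; split=> [|s s0|t]; first exact: measurable_funM.
  by rewrite f0// mulr0.
have [M HM] := bf t; exists (`|a| * M) => s st.
by rewrite normrM ler_wpM2l// HM.
Qed.

Lemma causalB f g : causal f -> causal g -> causal (fun s => f s - g s).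
Proof.
move=> cf cg; have := causalD cf (causalZ (-1) cg).
by under eq_fun do rewrite mulN1r.
Qed.

Lemma causal_norm f : causal f -> causal (fun s => `|f s|).
Proof.
move=> [mf f0 bf]; split=> [|s s0|t]; first exact: measurableT_comp.
  by rewrite f0// normr0.
by have [M HM] := bf t; exists M => s st; rewrite normr_id HM.
Qed.

Lemma integral_ker p a t : 0 < p -> a <= t ->
  (\int[mu]_s (ker p (t - s) * chi a s)%:E = ((t - a) `^ p / p)%:E)%E.
Proof.
move=> p0 le_at.
have N1 : (-1 : R) != 0 by rewrite oppr_eq0 oner_eq0.
have mk : measurable_fun setT (fun s => (ker p (t - s) * chi a s)%:E).
  apply/measurable_EFinP/measurable_funM; first exact: measurable_ker_sub.
  exact: measurable_indic.
rewrite (ge0_integral_affine t N1)//; last first.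
  by move=> x; rewrite lee_fin mulr_ge0// ?ker_ge0// chiE.
rewrite normrN1 mul1e -integral_powR ?subr_ge0// [RHS]integral_mkcond.
apply: eq_integral => r _ /=; rewrite patchE mem_setE in_itv/= chiE.
have -> : t - (-1 * r + t) = r by ring.
rewrite mulN1r [- r + t]addrC lerBrDr -lerBrDl /ker.
by case: (0 < r); case: (r <= t - a); rewrite /= ?mulr1 ?mulr0 ?mul0r.
Qed.

Lemma causal_le f t : causal f -> exists2 M, 0 < M &
  forall s, s <= t -> `|f s| <= M * chi 0 s.
Proof.
move=> [mf f0 bf]; have [M HM] := bf t.
exists (`|M| + 1) => [|s st]; first by rewrite ltr_wpDl.
rewrite chiE; have [s0|s0] := leP 0 s; last by rewrite f0// normr0 mulr0.
by rewrite mulr1 (le_trans (HM _ st))// ler_wpDr// ler_norm.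
Qed.

Lemma integrable_ker_chi p t : 0 < p ->
  mu.-integrable setT (EFin \o (fun s => ker p (t - s) * chi 0 s)).
Proof.
move=> p0; apply/integrableP; split.
  apply/measurable_EFinP/measurable_funM; first exact: measurable_ker_sub.
  exact: measurable_indic.
under eq_integral do rewrite /= ger0_norm ?mulr_ge0 ?ker_ge0 ?chiE//.
have [t0|t0] := leP 0 t.
  under eq_integral do rewrite -chiE.
  by rewrite integral_ker// ltry.
rewrite integral0_eq ?ltry// => s _; case: leP => s0; last by rewrite mulr0.
by rewrite ker_le0 ?mul0r// subr_le0 (le_trans (ltW t0)).
Qed.

Lemma integrable_ker p f t : 0 < p -> causal f ->
  mu.-integrable setT (EFin \o (fun s => ker p (t - s) * f s)).
Proof.
move=> p0 cf; have [M M0 HM] := causal_le t cf.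
have := integrableZl measurableT M (integrable_ker_chi t p0).
apply: le_integrable => //.
  apply/measurable_EFinP/measurable_funM; first exact: measurable_ker_sub.
  by case: cf.
move=> s _ /=; rewrite lee_fin normrM (ger0_norm (ker_ge0 _ _)).
rewrite [leRHS]ger0_norm; last first.
  by rewrite mulr_ge0 ?(ltW M0)// mulr_ge0 ?ker_ge0 ?chiE.
rewrite mulrCA; have [st|ts] := leP s t.
  by rewrite ler_wpM2l ?ker_ge0// HM.
by rewrite !ker_le0 ?mul0r// subr_le0 ltW.
Qed.

Lemma JD p f g t : 0 < p -> causal f -> causal g ->
  J p (fun s => f s + g s) t = J p f t + J p g t.
Proof.
move=> p0 cf cg; rewrite !JE -RintegralD//; try exact: integrable_ker.
by apply: eq_Rintegral => s _; rewrite mulrDr.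
Qed.

Lemma JB p f g t : 0 < p -> causal f -> causal g ->
  J p (fun s => f s - g s) t = J p f t - J p g t.
Proof.
move=> p0 cf cg; rewrite !JE -RintegralB//; try exact: integrable_ker.
by apply: eq_Rintegral => s _; rewrite mulrBr.
Qed.

Lemma JZ p a f t : 0 < p -> causal f -> J p (fun s => a * f s) t = a * J p f t.
Proof.
move=> p0 cf; rewrite !JE -RintegralZl//; last exact: integrable_ker.
by apply: eq_Rintegral => s _; rewrite mulrCA.
Qed.

Lemma J_le p f g t : 0 < p -> causal f -> causal g ->
  (forall s, 0 <= s < t -> f s <= g s) -> J p f t <= J p g t.
Proof.
move=> p0 cf cg fg; rewrite !JE; apply: le_Rintegral => //; try exact: integrable_ker.
move=> s _; have [st|ts] := ltP s t; last first.
  by rewrite !ker_le0 ?mul0r// subr_le0.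
have [s0|s0] := leP 0 s; last first.
  by case: cf => _ -> // _; case: cg => _ -> //.
by rewrite ler_wpM2l ?ker_ge0// fg// s0.
Qed.

Lemma J_chi p t : 0 < p -> 0 <= t -> J p (chi 0) t = t `^ p / p.
Proof. by move=> p0 t0; rewrite JE /Rintegral integral_ker// subr0. Qed.

Lemma J_neg p f t : causal f -> t <= 0 -> J p f t = 0.
Proof.
move=> [_ f0 _] t0; rewrite JE /Rintegral integral0_eq// => s _.
have [s0|s0] := leP 0 s; last by rewrite f0// mulr0.
by rewrite ker_le0 ?mul0r// subr_le0 (le_trans t0).
Qed.

(** For a nonincreasing kernel only the last step [t - e, t] contributes
    positively to the increment of J. The hypothesis on [s < t - e] covers the two
    uses: [h] nonnegative and [p <= 1], or [p = 1] and [h] of any sign, where the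
    kernel is constant and the product vanishes. *)
Lemma J_increment p h t e m : 0 < p -> 0 < e -> causal h ->
  (forall s, s < t - e -> (ker p (t - s) - ker p (t - e - s)) * h s <= 0) ->
  (forall s, t - e <= s < t -> h s <= m) -> 0 <= m ->
  J p h t - J p h (t - e) <= m * (e `^ p / p).
Proof.
move=> p0 e0 ch h1 h2 m0.
rewrite !JE -RintegralB//; try exact: integrable_ker.
have te : t - e <= t by lra.
have ik : mu.-integrable setT (EFin \o (fun s => ker p (t - s) * chi (t - e) s)).
  apply/integrableP; split.
    apply/measurable_EFinP/measurable_funM; first exact: measurable_ker_sub.
    exact: measurable_indic.
  under eq_integral do rewrite /= ger0_norm ?mulr_ge0 ?ker_ge0 ?chiE//.
  under eq_integral do rewrite -chiE.
  by rewrite integral_ker// ltry.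
have -> : m * (e `^ p / p) = \int[mu]_s (m * (ker p (t - s) * chi (t - e) s)).
  by rewrite RintegralZl// /Rintegral integral_ker//= subKr.
apply: le_Rintegral => //.
- exact: (integrableB measurableT (integrable_ker t p0 ch)
    (integrable_ker (t - e) p0 ch)).
- exact: (integrableZl measurableT m ik).
move=> s _; rewrite chiE; have [s1|s1] := leP (t - e) s; last first.
  by rewrite !mulr0 -mulrBl h1.
rewrite (@ker_le0 _ (t - e - s)) ?subr_le0// mul0r subr0 mulr1.
have [st|ts] := ltP s t; last by rewrite ker_le0 ?mul0r ?mulr0// subr_le0.
by rewrite mulrC ler_wpM2r ?ker_ge0// h2// s1.
Qed.

End riemann_liouville.

(** * Hoelder continuity and the semigroup property *)

Section semigroup.
Context {R : realType}.
Notation mu := (@lebesgue_measure R).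
Implicit Types (p q t s r a b m e : R) (f g h : R -> R).

Lemma J_chi_homo p s t : 0 < p -> s <= t ->
  J p (chi 0) s <= J p (chi 0) t.
Proof.
move=> p0 st; have [s0|s0] := leP s 0.
  rewrite (J_neg p causal_chi s0); have [t0|/ltW t0] := leP t 0.
    by rewrite J_neg//; exact: causal_chi.
  by rewrite J_chi// divr_ge0 ?powR_ge0// ltW.
have t0 := le_trans (ltW s0) st.
rewrite !J_chi ?(ltW s0)// ler_pM2r ?invr_gt0//.
by rewrite ge0_ler_powR// ?nnegrE ?(ltW p0) ?(ltW s0).
Qed.

(** Adding [M] on the half line makes [f] nonnegative with values at most 2 M
    there, and the primitive of the added part is nondecreasing. *)
Lemma J_increment_bound p f t e (M : R) : 0 < p <= 1 -> 0 < e -> causal f ->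
  (forall s, s <= t -> `|f s| <= M) ->
  J p f t - J p f (t - e) <= 2 * M / p * e `^ p.
Proof.
move=> /andP[p0 p1] e0 cf fM.
have M0 : 0 <= M by rewrite (le_trans _ (fM _ (lexx t))).
have cc := @causal_chi R.
have cg := causalD cf (causalZ M cc).
have : J p (fun s => f s + M * chi 0 s) t -
    J p (fun s => f s + M * chi 0 s) (t - e) <= (2 * M) * (e `^ p / p).
  apply: J_increment => //; last by rewrite mulr_ge0.
    move=> s st; rewrite mulr_le0_ge0//.
      rewrite subr_le0; apply: ker_nonincreasing => //; first by rewrite subr_gt0.
      by rewrite lerD2r; lra.
    rewrite chiE; have [s0|s0] := leP 0 s; last first.
      by case: cf => _ -> // _; rewrite mulr0 addr0.
    have := fM s; rewrite ler_norml mulr1 => H; have /H/andP[] : s <= t by lra.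
    by lra.
  move=> s /andP[_ st]; rewrite chiE.
  have := fM s (ltW st); rewrite ler_norml => /andP[_ H].
  by case: (0 <= s); rewrite ?mulr1 ?mulr0 ?addr0; lra.
rewrite !(JD _ p0 cf (causalZ M cc)) !(JZ M _ p0 cc).
have : M * J p (chi 0) (t - e) <= M * J p (chi 0) t.
  by rewrite ler_wpM2l// J_chi_homo//; lra.
rewrite (_ : 2 * M * (e `^ p / p) = 2 * M / p * e `^ p); last by ring.
lra.
Qed.

Lemma J_holder p f t s (M : R) : 0 < p <= 1 -> causal f -> s <= t ->
  (forall r, r <= t -> `|f r| <= M) ->
  `|J p f t - J p f s| <= 2 * M / p * (t - s) `^ p.
Proof.
move=> p01 cf; rewrite le_eqVlt => /predU1P[->|st] fM.
  have p0 : p != 0 by case/andP: p01 => p0 _; rewrite gt_eqF.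
  by rewrite !subrr normr0 powR0// mulr0.
have e0 : 0 < t - s by rewrite subr_gt0.
have -> : J p f s = J p f (t - (t - s)) by rewrite subKr.
rewrite ler_norml; apply/andP; split; last exact: J_increment_bound.
have p0 : 0 < p by case/andP: p01.
have := @J_increment_bound p (fun s => -1 * f s) t (t - s) M p01 e0
  (causalZ (-1) cf).
have fM' r : r <= t -> `|-1 * f r| <= M by rewrite mulN1r normrN; exact: fM.
by rewrite !JZ// => /(_ fM'); lra.
Qed.

Lemma continuous_J p f : 0 < p <= 1 -> causal f -> continuous (J p f).
Proof.
move=> p01 cf x; have p0 : 0 < p by case/andP: p01.
have [M M0 HM] := causal_le (x + 1) cf.
have fM r : r <= x + 1 -> `|f r| <= M.
  move=> /HM /le_trans; apply; rewrite chiE.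
  by case: (0 <= r); rewrite ?mulr1 ?mulr0// ltW.
apply/cvgrPdist_le => e e0.
pose d := (e * p / (2 * M)) `^ p^-1.
have d0 : 0 < d by rewrite powR_gt0// divr_gt0 ?mulr_gt0.
have dp : 2 * M / p * d `^ p = e.
  rewrite -powRrM mulVf ?gt_eqF// powRr1; last by rewrite divr_ge0 ?mulr_ge0// ltW.
  by field; rewrite !gt_eqF.
have H s t : s <= t -> t <= x + 1 -> t - s <= d -> `|J p f t - J p f s| <= e.
  move=> st tx td; have fM' r : r <= t -> `|f r| <= M.
    by move=> rt; rewrite fM// (le_trans rt).
  rewrite (le_trans (J_holder p01 cf st fM'))// -dp ler_wpM2l//.
    by rewrite divr_ge0 ?mulr_ge0 ?ltW.
  by rewrite ge0_ler_powR// ?nnegrE ?(ltW p0) ?subr_ge0// ltW.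
near=> y.
have yx : `|x - y| <= d by near: y; exact: cvgr_dist_le.
have y1 : `|x - y| <= 1 by near: y; exact: cvgr_dist_le.
have [xy|/ltW xy] := leP x y.
  by rewrite distrC H//; move: yx y1; rewrite !ler_norml => /andP[? ?] /andP[? ?]; lra.
by rewrite H//; move: yx y1; rewrite !ler_norml => /andP[? ?] /andP[? ?]; lra.
Unshelve. all: by end_near. Qed.

Lemma causal_J p f : 0 < p <= 1 -> causal f -> causal (J p f).
Proof.
move=> p01 cf; have p0 : 0 < p by case/andP: p01.
split=> [|s s0|t].
- by apply: continuous_measurable_fun; exact: continuous_J.
- by rewrite J_neg// ltW.
have [M M0 HM] := causal_le t cf.
have fM r : r <= t -> `|f r| <= M.
  move=> /HM /le_trans; apply; rewrite chiE.
  by case: (0 <= r); rewrite ?mulr1 ?mulr0// ltW.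
exists (2 * M / p * t `^ p) => s st.
have c0 : 0 <= 2 * M / p by rewrite divr_ge0 ?mulr_ge0 ?ltW.
have [s0|s0] := leP s 0; first by rewrite J_neg// normr0 mulr_ge0// powR_ge0.
have fM' r : r <= s -> `|f r| <= M by move=> rs; rewrite fM// (le_trans rs).
have := J_holder p01 cf (ltW s0) fM'; rewrite (@J_neg _ p f 0)// !subr0.
move=> /le_trans; apply; rewrite ler_wpM2l// ge0_ler_powR// ?nnegrE ?(ltW p0) ?(ltW s0)//.
by rewrite (le_trans (ltW s0)).
Qed.

(** Euler's beta integral. *)
Definition ebeta p q : \bar R := (\int[mu]_r (ker p (1 - r) * ker q r)%:E)%E.

Lemma ebetaC p q : ebeta p q = ebeta q p.
Proof.
have N1 : (-1 : R) != 0 by rewrite oppr_eq0 oner_eq0.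
rewrite /ebeta (ge0_integral_affine 1 N1); last first.
- by move=> r; rewrite lee_fin mulr_ge0 ?ker_ge0.
- apply/measurable_EFinP/measurable_funM; last exact: measurable_ker.
  exact: measurable_ker_sub.
rewrite normrN1 mul1e; apply: eq_integral => r _.
by rewrite mulN1r opprD opprK addrCA subrr addr0 addrC mulrC.
Qed.

Lemma ker_scale p c r : 0 < c -> ker p (c * r) = c `^ (p - 1) * ker p r.
Proof.
move=> c0; rewrite /ker pmulr_rgt0//; case: ifPn => r0; last by rewrite mulr0.
by rewrite powRM// ltW.
Qed.

(** Affine substitution maps [s, t] to [0, 1]. *)
Lemma integral_ker_ker p q s t : 0 < p -> 0 < q ->
  (\int[mu]_r (ker p (t - r) * ker q (r - s))%:E =
   (ker (p + q) (t - s))%:E * ebeta p q)%E.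
Proof.
move=> p0 q0; have [st|ts] := ltP s t; last first.
  rewrite ker_le0 ?subr_le0// mul0e integral0_eq// => r _.
  have [tr|rt] := leP t r; first by rewrite ker_le0 ?subr_le0// mul0r.
  by rewrite (@ker_le0 _ q) ?mulr0// subr_le0 (le_trans (ltW rt)).
have c0 : 0 < t - s by rewrite subr_gt0.
have mk : measurable_fun setT (fun r => ker p (t - r) * ker q (r - s)).
  apply: measurable_funM; first exact: measurable_ker_sub.
  by apply: measurableT_comp; [exact: measurable_ker|exact: measurable_funB].
rewrite (ge0_integral_affine s (lt0r_neq0 c0)); last first.
- by move=> r; rewrite lee_fin mulr_ge0 ?ker_ge0.
- exact/measurable_EFinP.
rewrite (gtr0_norm c0) (kerE _ c0).
have -> : (t - s) `^ (p + q - 1) = (t - s) * ((t - s) `^ (p - 1) * (t - s) `^ (q - 1)).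
  rewrite mulrA mulr_powRB1 ?(ltW c0)// -powRD ?addrA//.
  by rewrite (gt_eqF c0) implybT.
rewrite EFinM -muleA; congr (_ * _)%E.
rewrite /ebeta -ge0_integralZl_EFin//; last first.
- by rewrite mulr_ge0 ?powR_ge0.
- apply/measurable_EFinP/measurable_funM; last exact: measurable_ker.
  exact: measurable_ker_sub.
- by move=> r _; rewrite lee_fin mulr_ge0 ?ker_ge0.
apply: eq_integral => r _; rewrite -EFinM.
have -> : t - ((t - s) * r + s) = (t - s) * (1 - r) by ring.
have -> : (t - s) * r + s - s = (t - s) * r by ring.
by rewrite !ker_scale//; congr _%:E; ring.
Qed.

Lemma ker_le2 p r : 0 < p <= 1 -> 1/2 <= r -> ker p r <= 2.
Proof.
move=> /andP[p0 p1] r2; have h0 : (0 < 1/2 :> R) by lra.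
apply: (le_trans (ker_nonincreasing p1 h0 r2)).
have pE : p - 1 = - (1 - p) by ring.
rewrite kerE// pE powRN invf_ple ?posrE ?powR_gt0//.
have E2 : 2^-1 = (1 / 2 : R) `^ 1 by rewrite powRr1 ?div1r// ltW.
rewrite [leLHS]E2.
by apply: ger_powR; lra.
Qed.

Lemma ker_ge1 p r : 0 < p <= 1 -> 0 < r <= 1 -> 1 <= ker p r.
Proof.
move=> /andP[p0 p1] /andP[r0 r1].
have -> : 1 = ker p 1 by rewrite kerE// powR1.
exact: ker_nonincreasing.
Qed.

(** Each of the two singularities is integrable, and at every point of ]0, 1[ one
    of the factors is at most 2 because [p, q <= 1]. *)
Lemma ebeta_fin p q : 0 < p <= 1 -> 0 < q <= 1 -> (1 <= ebeta p q < +oo)%E.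
Proof.
move=> p01 q01; have [/andP[p0 p1] /andP[q0 q1]] := (p01, q01).
have mk : measurable_fun setT (fun r => ker p (1 - r) * ker q r).
  apply: measurable_funM; last exact: measurable_ker.
  exact: measurable_ker_sub.
apply/andP; split.
  have -> : 1%E = (\int[mu]_r (\1_(`]0, 1[%classic) r)%:E)%E.
    rewrite integral_indic//= setIT lebesgue_measure_itv/= lte_fin ltr01.
    by rewrite oppr0 adde0.
  apply: ge0_le_integral => //.
  - by apply/measurable_EFinP; exact: measurable_indic.
  - exact/measurable_EFinP.
  move=> r _; rewrite lee_fin indicE mem_setE in_itv/=.
  have [/andP[r0 r1]|_] := boolP (0 < r < 1); last by rewrite mulr_ge0 ?ker_ge0.
  by rewrite -[leLHS]mulr1 ler_pM// ker_ge1//; lra.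
have mk1 a : measurable_fun setT (fun r => ker a (1 - r) * chi 0 r).
  apply: measurable_funM; first exact: measurable_ker_sub.
  exact: measurable_indic.
(* G dominates the integrand; its two terms are mirror images. *)
pose G r := 2 * (ker p (1 - r) * chi 0 r) + 2 * (ker q r * chi 0 (1 - r)).
have k1 a (r : R) : 0 <= ker a (1 - r) * chi 0 r.
  by rewrite mulr_ge0 ?ker_ge0// chiE.
have k2 a (r : R) : 0 <= ker a r * chi 0 (1 - r).
  by rewrite mulr_ge0 ?ker_ge0// chiE.
have m2 a : measurable_fun setT (fun r : R => ker a r * chi 0 (1 - r)).
  apply: measurable_funM; first exact: measurable_ker.
  by apply: measurableT_comp; [exact: measurable_indic|exact: measurable_funB].
have mG : measurable_fun setT G.
  by apply: measurable_funD; apply: measurable_funM.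
apply: (@le_lt_trans _ _ (\int[mu]_r (G r)%:E)%E).
  apply: ge0_le_integral => //.
  - by move=> r _; rewrite lee_fin mulr_ge0 ?ker_ge0.
  - exact/measurable_EFinP.
  - exact/measurable_EFinP.
  move=> r _; rewrite lee_fin /G !chiE subr_ge0.
  have [r0|r0] := leP r 0.
    by rewrite !(ker_le0 q r0) mulr0 !mul0r mulr0 addr0 !mulr_ge0 ?ker_ge0.
  have [r1|r1] := leP 1 r.
    rewrite !(@ker_le0 _ p) ?subr_le0// !mul0r mulr0 add0r.
    by rewrite !mulr_ge0 ?ker_ge0.
  rewrite (ltW r0) (ltW r1) !mulr1.
  have A1 := ker_ge0 p (1 - r); have A2 := ker_ge0 q r.
  have [r2|r2] := leP r (1/2).
    have : ker p (1 - r) <= 2 by apply: ker_le2 => //; lra.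
    by move: A1 A2; nra.
  have : ker q r <= 2 by apply: ker_le2 => //; lra.
  by move: A1 A2; nra.
rewrite /G; under eq_integral do rewrite EFinD !EFinM -!EFinM.
rewrite ge0_integralD//; last first.
- by apply/measurable_EFinP; apply: measurable_funM => //; exact: m2.
- by move=> r _; rewrite lee_fin mulr_ge0.
- by apply/measurable_EFinP; apply: measurable_funM => //; exact: mk1.
- by move=> r _; rewrite lee_fin mulr_ge0.
have Z h : measurable_fun setT h -> (forall r, 0 <= h r) ->
    (\int[mu]_r (2 * h r)%:E = 2%:E * \int[mu]_r (h r)%:E)%E.
  move=> mh h0; under eq_integral do rewrite EFinM.
  rewrite ge0_integralZl_EFin//; first by move=> r _; rewrite lee_fin.
  exact/measurable_EFinP.
rewrite (Z _ (mk1 p))// (Z _ (m2 q))//.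
have -> : (\int[mu]_r (ker q r * chi 0 (1 - r))%:E)%E =
    (\int[mu]_r (ker q (1 - r) * chi 0 r)%:E)%E.
  have N1 : (-1 : R) != 0 by rewrite oppr_eq0 oner_eq0.
  rewrite (ge0_integral_affine 1 N1); last first.
  - by move=> r; rewrite lee_fin.
  - exact/measurable_EFinP.
  rewrite normrN1 mul1e; apply: eq_integral => r _.
  by rewrite mulN1r opprD opprK addrCA subrr addr0 addrC.
by rewrite !integral_ker// -!EFinM -EFinD ltry.
Qed.

Definition beta p q : R := fine (ebeta p q).

Lemma EFin_beta p q : 0 < p <= 1 -> 0 < q <= 1 -> (beta p q)%:E = ebeta p q.
Proof.
move=> p01 q01; have /andP[b1 b2] := ebeta_fin p01 q01.
by rewrite fineK// ge0_fin_numE// (le_trans _ b1)// lee_fin.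
Qed.

Lemma betaC p q : beta p q = beta q p.
Proof. by rewrite /beta ebetaC. Qed.

Lemma beta_gt0 p q : 0 < p <= 1 -> 0 < q <= 1 -> 0 < beta p q.
Proof.
move=> p01 q01; have /andP[b1 _] := ebeta_fin p01 q01.
by rewrite -lte_fin EFin_beta// (lt_le_trans _ b1)// lte_fin.
Qed.

Lemma EFin_J p f t : 0 < p -> causal f ->
  (J p f t)%:E = (\int[mu]_s (ker p (t - s) * f s)%:E)%E.
Proof. by move=> p0 cf; rewrite JE fineK// integrable_fin_num// integrable_ker. Qed.

(** Tonelli's theorem and [integral_ker_ker]. *)
Lemma ge0_J_J p q f t : 0 < p <= 1 -> 0 < q <= 1 -> causal f ->
  (forall s, 0 <= f s) -> J p (J q f) t = beta p q * J (p + q) f t.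
Proof.
move=> p01 q01 cf f0; have [/andP[p0 p1] /andP[q0 q1]] := (p01, q01).
have mf : measurable_fun setT f by case: cf.
apply: EFin_inj; rewrite EFinM EFin_beta// !EFin_J//; last 2 first.
- exact: addr_gt0.
- exact: causal_J.
transitivity (\int[mu]_r \int[mu]_s (ker p (t - r) * (ker q (r - s) * f s))%:E)%E.
  apply: eq_integral => r _; rewrite EFinM EFin_J// -ge0_integralZl_EFin ?ker_ge0//.
  - by move=> s _; rewrite lee_fin mulr_ge0 ?ker_ge0.
  - apply/measurable_EFinP/measurable_funM => //; exact: measurable_ker_sub.
have mF : measurable_fun setT (fun z : R * R =>
    (ker p (t - z.1) * (ker q (z.1 - z.2) * f z.2))%:E).
  apply/measurable_EFinP; apply: measurable_funM.
    apply: measurableT_comp; first exact: measurable_ker.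
    by apply: measurable_funB.
  apply: measurable_funM.
    by apply: measurableT_comp; [exact: measurable_ker|exact: measurable_funB].
  exact: measurableT_comp.
have F0 z : (0 <= (ker p (t - z.1) * (ker q (z.1 - z.2) * f z.2))%:E)%E.
  by rewrite lee_fin mulr_ge0 ?ker_ge0// mulr_ge0 ?ker_ge0.
have /= -> := @fubini_tonelli _ _ _ _ _ mu mu _ mF F0.
rewrite muleC -ge0_integralZr//; last first.
- by rewrite -EFin_beta// lee_fin ltW// beta_gt0.
- by move=> s _; rewrite lee_fin mulr_ge0 ?ker_ge0.
- apply/measurable_EFinP/measurable_funM => //; exact: measurable_ker_sub.
apply: eq_integral => s _.
rewrite EFinM muleAC -integral_ker_ker// -ge0_integralZr//.
- apply: eq_integral => r _; rewrite -EFinM mulrA//.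
- apply/measurable_EFinP/measurable_funM; first exact: measurable_ker_sub.
  by apply: measurableT_comp; [exact: measurable_ker|exact: measurable_funB].
- by move=> r _; rewrite lee_fin mulr_ge0 ?ker_ge0.
- by rewrite lee_fin.
Qed.

(** The semigroup property of fractional integration. The absolute value reduces
    it to nonnegative functions. *)
Lemma J_J p q f t : 0 < p <= 1 -> 0 < q <= 1 -> causal f ->
  J p (J q f) t = beta p q * J (p + q) f t.
Proof.
move=> p01 q01 cf; have [/andP[p0 p1] /andP[q0 q1]] := (p01, q01).
have cn := causal_norm cf.
have cd := causalB cn cf.
have E s : f s = `|f s| - (`|f s| - f s) by ring.
have -> : f = fun s => `|f s| - (`|f s| - f s) by apply/funext.
rewrite [J q _](_ : _ = fun s => J q (fun s => `|f s|) s - J q (fun s => `|f s| - f s) s); last first.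
  by apply/funext => s; rewrite JB.
rewrite (JB _ p0 (causal_J q01 cn) (causal_J q01 cd)).
rewrite (JB _ (addr_gt0 p0 q0) cn cd) mulrBr !ge0_J_J// => s.
by rewrite subr_ge0 ler_norm.
Qed.

End semigroup.

(** * The Lyapunov inequality *)

Section lyapunov.
Context {R : realType}.
Notation mu := (@lebesgue_measure R).
Implicit Types (p q t s r a b m e c : R) (f g h F : R -> R).

(** If increments over steps of length e are bounded below by -c e^(1 + q), then
    n equal steps lose at most c (b - a)^(1 + q) n^(-q) altogether. *)
Lemma le_of_superlinear F a b c q : 0 < q -> a < b -> 0 <= c ->
  (forall s t, a <= s -> s < t -> t <= b ->
    - (c * (t - s) `^ (1 + q)) <= F t - F s) -> F a <= F b.
Proof.
move=> q0 ab c0 HF; rewrite leNgt; apply/negP => Fba.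
set eta := F a - F b; have eta0 : 0 < eta by rewrite subr_gt0.
pose d := b - a; have d0 : 0 < d by rewrite subr_gt0.
pose K := c * d `^ (1 + q) / eta.
have K0 : 0 <= K by rewrite divr_ge0 ?(ltW eta0)// mulr_ge0 ?powR_ge0.
(* With n^q > K the total loss c d^(1 + q) n^(-q) is less than eta. *)
pose n := (Num.truncn (K `^ q^-1)).+1.
have nK : K `^ q^-1 < n%:R by exact: truncnS_gt.
have n0 : 0 < n%:R :> R by rewrite ltr0n.
have Kn : K < n%:R `^ q.
  have -> : K = (K `^ q^-1) `^ q by rewrite -powRrM mulVf ?lt0r_neq0// powRr1.
  by rewrite gt0_ltr_powR// nnegrE ?powR_ge0 ?ltW.
pose x (i : nat) := a + i%:R * (d / n%:R).
have dn0 : 0 < d / n%:R by rewrite divr_gt0.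
have xS i : x i.+1 - x i = d / n%:R by rewrite /x -natr1; ring.
have x0 : x 0%N = a by rewrite /x mul0r addr0.
have xn : x n = b by rewrite /x mulrC divfK ?gt_eqF// /d; ring.
have xle i j : (i <= j)%N -> x i <= x j.
  by move=> ij; rewrite lerD2l ler_pM2r// ler_nat.
have : \sum_(0 <= i < n) - (c * (d / n%:R) `^ (1 + q)) <= F b - F a.
  rewrite -{1}xn -{1}x0 -(telescope_sumr (F \o x))//=.
  rewrite big_nat [leRHS]big_nat; apply: ler_sum => i /andP[_ ni].
  rewrite -(xS i); apply: HF.
  - by rewrite -x0 xle.
  - by rewrite -subr_gt0 xS.
  - by rewrite -xn xle.
rewrite sumr_const_nat subn0 -[leLHS]mulr_natl => H.
have : n%:R * - (c * (d / n%:R) `^ (1 + q)) = - (c * d `^ (1 + q) / n%:R `^ q).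
  rewrite powRM ?(ltW d0) ?invr_ge0 ?(ltW n0)// mulrN; congr (- _).
  have -> : (n%:R^-1 : R) `^ (1 + q) = (n%:R * n%:R `^ q)^-1.
    rewrite -powR_inv1 ?(ltW n0)// -powRrM mulN1r powRN powRD.
      by rewrite powRr1 ?(ltW n0).
    by rewrite (gt_eqF n0) implybT.
  by field; rewrite !gt_eqF// powR_gt0.
move=> E; rewrite E in H.
have : c * d `^ (1 + q) / n%:R `^ q < eta.
  by rewrite ltr_pdivrMr ?powR_gt0// [ltRHS]mulrC -ltr_pdivrMr.
by rewrite /eta; lra.
Qed.

Lemma integrable_reflect t f : measurable_fun setT f ->
  mu.-integrable setT (EFin \o f) ->
  mu.-integrable setT (EFin \o (fun s => f (t - s))).
Proof.
move=> mf /integrableP[_ fi]; apply/integrableP; split.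
  by apply/measurable_EFinP; apply: measurableT_comp => //; exact: measurable_funB.
have N1 : (-1 : R) != 0 by rewrite oppr_eq0 oner_eq0.
move: fi; rewrite (ge0_integral_affine t N1); last first.
- by move=> r; exact: abse_ge0.
- by apply: measurableT_comp => //; exact/measurable_EFinP.
rewrite normrN1 mul1e; congr (_ < _)%E; apply: eq_integral => r _ /=.
by rewrite mulN1r addrC.
Qed.

(** The reflection [s := t - r] moves the dependence on [t] from the kernel to
    the function. *)
Lemma J_homo p F : 0 < p -> causal F -> {homo F : s t / s <= t} ->
  {homo J p F : s t / s <= t}.
Proof.
move=> p0 cF hF s t st; have mF : measurable_fun setT F by case: cF.
have mk x : measurable_fun setT (fun r => ker p (x - r) * F r).
  by apply: measurable_funM => //; exact: measurable_ker_sub.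
rewrite !JE (Rintegral_reflect s (mk s)) (Rintegral_reflect t (mk t)).
apply: le_Rintegral => //.
- exact: (integrable_reflect s (mk s) (integrable_ker s p0 cF)).
- exact: (integrable_reflect t (mk t) (integrable_ker t p0 cF)).
by move=> r _; rewrite !subKr ler_wpM2l ?ker_ge0// hF// lerD2r.
Qed.

(** A continuous function with a nondecreasing primitive is nonnegative: were it
    below -c near a point, its primitive would decrease there. *)
Lemma ge0_of_J1_homo G : causal G -> continuous G ->
  {homo J 1 G : s t / s <= t} -> forall t, 0 <= t -> 0 <= G t.
Proof.
move=> cG ctG hG.
have pos t : 0 < t -> 0 <= G t.
  move=> t0; rewrite leNgt; apply/negP => Gt.
  pose c := - G t / 2; have c0 : 0 < c by rewrite divr_gt0// oppr_gt0.
  have /cvgrPdist_lt /(_ c c0) /nbhs_ballP[d /= d0 Hd] := ctG t.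
  pose e := Num.min (d / 2) (t / 2).
  have e0 : 0 < e by rewrite lt_min !divr_gt0.
  have [ed et] : e <= d / 2 /\ e <= t / 2 by rewrite !ge_min !lexx orbT.
  have cc := @causal_chi R.
  have : J 1 (fun s => G s + c * chi 0 s) t
     - J 1 (fun s => G s + c * chi 0 s) (t - e) <= 0 * (e `^ 1 / 1).
    apply: J_increment => //.
    - by apply: causalD => //; exact: causalZ.
    - move=> s st; rewrite !kerE ?subr_gt0// ?subrr ?powRr0 ?subrr ?mul0r//; lra.
    - move=> s /andP[s1 s2]; rewrite chiE.
      have -> : 0 <= s by lra.
      have /Hd : ball t d s.
        by rewrite /ball/= gtr0_norm ?subr_gt0//; lra.
      by rewrite mulr1 ltr_norml /c => /andP[? ?]; lra.
  rewrite !(JD _ ltr01 cG (causalZ c cc)) !(JZ c _ ltr01 cc).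
  rewrite !J_chi ?(ltW t0)//; last by lra.
  rewrite !powRr1 ?(ltW t0)//; last 2 first.
  - by lra.
  - exact: ltW.
  have : J 1 G (t - e) <= J 1 G t by apply: hG; lra.
  have : 0 < c * e by rewrite mulr_gt0.
  by lra.
move=> t; rewrite le_eqVlt => /predU1P[<-|]; last exact: pos.
rewrite leNgt; apply/negP => G0.
have c0 : 0 < - G 0 by rewrite oppr_gt0.
have /cvgrPdist_lt /(_ _ c0) /nbhs_ballP[d /= d0 Hd] := ctG 0.
have d2 : 0 < d / 2 by rewrite divr_gt0.
have /Hd : ball 0 d (d / 2).
  by rewrite /ball/= sub0r normrN gtr0_norm//; lra.
have := pos _ d2.
by rewrite ltr_norml => ? /andP[? ?]; lra.
Qed.

Section scalar.
Variables (alpha : R) (f : R -> R).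
Hypothesis alpha01 : 0 < alpha < 1.
Hypothesis cf : causal f.
Let w := J alpha f.

Let a0 : 0 < alpha. Proof. by case/andP: alpha01. Qed.
Let a1 : 0 < 1 - alpha. Proof. by case/andP: alpha01; rewrite subr_gt0. Qed.
Let aP : 0 < alpha <= 1. Proof. by rewrite a0; case/andP: alpha01 => _ /ltW. Qed.
Let bP : 0 < 1 - alpha <= 1. Proof. by rewrite a1; have := a0; lra. Qed.
Let oP : 0 < (1 : R) <= 1. Proof. by rewrite ltr01 lexx. Qed.
Let cw : causal w. Proof. exact: causal_J. Qed.
Let cww : causal (fun s => w s * w s). Proof. exact: causalM. Qed.
Let cwf : causal (fun s => w s * f s). Proof. exact: causalM. Qed.
Let be := beta (1 - alpha) alpha.
Let be0 : 0 < be. Proof. exact: beta_gt0. Qed.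
Let F t := (2 * be) * J 1 (fun s => w s * f s) t - J (1 - alpha) (fun s => w s * w s) t.

(** In terms of [w], this is the Caputo derivative in integrated form. *)
Let w_caputo t : J (1 - alpha) w t = be * J 1 f t.
Proof. by rewrite J_J// subrK. Qed.

(** Expand the square (w t - w r)^2 under J (1 - alpha): the increment over [s, t]
    of J (1 - alpha) (w w) is at most 2 w(t) times that of J (1 - alpha) w, which
    is [be] times the integral of [f]. The errors, from expanding the square and
    from moving w(t) under the integral of [f], are of higher order because [w] is
    Hoelder continuous. *)
Let F_increment b : exists2 c, 0 <= c & forall s t, s < t -> t <= b ->
    - (c * (t - s) `^ (1 + alpha)) <= F t - F s.
Proof.
have [M M0 HM] := causal_le b cf.
have fM r : r <= b -> `|f r| <= M.
  move=> /HM /le_trans; apply; rewrite chiE.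
  by case: (0 <= r); rewrite ?mulr1 ?mulr0// ltW.
pose H := 2 * M / alpha.
have H0 : 0 < H by rewrite divr_gt0// mulr_gt0.
exists (2 * be * (H * M) + H ^+ 2 / (1 - alpha)).
  apply: addr_ge0; first by apply: mulr_ge0; apply: mulr_ge0 => //; exact: ltW.
  by rewrite divr_ge0 ?sqr_ge0 ?(ltW a1).
move=> s t st tb; pose e := t - s; have e0 : 0 < e by rewrite subr_gt0.
have sE : s = t - e by rewrite subKr.
have wH r : s <= r -> r < t -> `|w t - w r| <= H * e `^ alpha.
  move=> sr rt; have fM' x : x <= t -> `|f x| <= M.
    by move=> xt; rewrite fM// (le_trans xt).
  rewrite (le_trans (J_holder aP cf (ltW rt) fM'))// ler_wpM2l ?(ltW H0)//.
  by rewrite ge0_ler_powR// ?nnegrE ?(ltW a0) ?subr_ge0 ?(ltW rt) ?(ltW st)// lerD2l lerN2.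
have cc := @causal_chi R.
have E1 : J (1 - alpha) (fun s => w s * w s) t - J (1 - alpha) (fun s => w s * w s) s
   <= 2 * w t * (be * J 1 f t - be * J 1 f s) + H ^+ 2 / (1 - alpha) * e `^ (1 + alpha).
  (* h is the square of w t - w on the half line, so that its contribution is
     controlled on the last step and has the right sign before it. *)
  pose h r := w r * w r - (2 * w t) * w r + (w t ^+ 2) * chi 0 r.
  have hE r : h r = (w t - w r) ^+ 2 * chi 0 r.
    rewrite /h chiE; have [r0|r0] := leP 0 r; first by rewrite /=; ring.
    by have -> : w r = 0 by [case: cw => _ -> //]; rewrite /=; ring.
  have c2 := causalZ (2 * w t) cw.
  have c3 := causalZ (w t ^+ 2) cc.
  have c1 := causalB cww c2.
  have ch : causal h by exact: causalD.
  have : J (1 - alpha) h t - J (1 - alpha) h s <=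
      (H * e `^ alpha) ^+ 2 * (e `^ (1 - alpha) / (1 - alpha)).
    rewrite sE; apply: J_increment => //.
    - move=> r rt; rewrite hE mulr_le0_ge0//.
        rewrite subr_le0; apply: ker_nonincreasing; first by case/andP: bP.
          by rewrite subr_gt0.
        by rewrite lerD2r; lra.
      by rewrite mulr_ge0 ?sqr_ge0// chiE.
    - rewrite -sE => r /andP[sr rt]; rewrite hE chiE.
      have : (w t - w r) ^+ 2 <= (H * e `^ alpha) ^+ 2.
        by rewrite -[leLHS]real_normK ?num_real// ler_sqr ?nnegrE ?wH// mulr_ge0 ?powR_ge0 ?ltW.
      by case: (0 <= r) => //=; rewrite ?mulr1// mulr0 sqr_ge0.
    - exact: sqr_ge0.
  have -> : (H * e `^ alpha) ^+ 2 * (e `^ (1 - alpha) / (1 - alpha)) =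
      H ^+ 2 / (1 - alpha) * e `^ (1 + alpha).
    have -> : 1 + alpha = alpha + alpha + (1 - alpha) by ring.
    have ene : e != 0 by rewrite gt_eqF.
    by rewrite !powRD ?ene ?implybT//; ring.
  rewrite !(JD _ a1 c1 c3) !(JB _ a1 cww c2) !(JZ _ _ a1 cw) !(JZ _ _ a1 cc) !w_caputo.
  have : w t ^+ 2 * J (1 - alpha) (chi 0) s <= w t ^+ 2 * J (1 - alpha) (chi 0) t.
    by rewrite ler_wpM2l ?sqr_ge0// J_chi_homo// ltW.
  lra.
have E2 : w t * (J 1 f t - J 1 f s) - (H * M) * e `^ (1 + alpha) <=
    J 1 (fun s => w s * f s) t - J 1 (fun s => w s * f s) s.
  have c1 := causalZ (w t) cf.
  have : J 1 (fun r => w t * f r - w r * f r) t - J 1 (fun r => w t * f r - w r * f r) s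
     <= (H * e `^ alpha * M) * (e `^ 1 / 1).
    rewrite sE; apply: J_increment => //.
    - exact: causalB.
    - move=> r rt; rewrite !kerE ?subr_gt0// ?subrr ?powRr0 ?subrr ?mul0r//; lra.
    - rewrite -sE => r /andP[sr rt]; rewrite -mulrBl (le_trans (ler_norm _))// normrM.
      by rewrite ler_pM// ?wH// fM// (le_trans (ltW rt)).
    - by apply: mulr_ge0; [apply: mulr_ge0; [exact: ltW|exact: powR_ge0]|exact: ltW].
  rewrite !(JB _ ltr01 c1 cwf) !(JZ _ _ ltr01 cf).
  have -> : e `^ (1 + alpha) = e `^ 1 * e `^ alpha.
    by rewrite powRD// (gt_eqF e0) implybT.
  lra.
have E3 : (2 * be) * (w t * (J 1 f t - J 1 f s) - (H * M) * e `^ (1 + alpha)) <=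
   (2 * be) * (J 1 (fun s => w s * f s) t - J 1 (fun s => w s * f s) s).
  by rewrite ler_wpM2l// mulr_ge0// ltW.
rewrite /F -/e; lra.
Qed.

Let F_homo : {homo F : s t / s <= t}.
Proof.
move=> s t; rewrite le_eqVlt => /predU1P[->//|st].
have [c c0 Hc] := F_increment t.
by apply: (le_of_superlinear a0 st c0) => s' t' _; exact: Hc.
Qed.

Let cJwf : causal (J alpha (fun s => w s * f s)). Proof. exact: causal_J. Qed.

(** J alpha maps the nondecreasing function [F] to a nondecreasing function,
    which is [be] times the primitive of 2 J (w f) - w^2 by the semigroup
    property. *)
Lemma sqr_J_le t : 0 <= t ->
  J alpha f t ^+ 2 <= 2 * J alpha (fun s => J alpha f s * f s) t.
Proof.
move=> t0.
have c1 : causal (fun s => (2 * be) * J 1 (fun s => w s * f s) s).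
  by apply: causalZ; exact: causal_J.
have c2 : causal (J (1 - alpha) (fun s => w s * w s)) by exact: causal_J.
have cF : causal F by exact: causalB.
pose G s := 2 * J alpha (fun s => w s * f s) s - w s * w s.
have cG : causal G by apply: causalB => //; exact: causalZ.
suff : 0 <= G t by rewrite /G subr_ge0 -expr2.
apply: ge0_of_J1_homo => //.
  move=> x; apply: cvgB; first by apply: cvgMr; exact: continuous_J.
  by apply: cvgM; exact: continuous_J.
have JFE s : J alpha F s = be * J 1 G s.
  have c3 : causal (J 1 (fun s => w s * f s)) by exact: causal_J.
  rewrite (JB _ a0 c1 c2) (JZ _ _ a0 c3) J_J// J_J//.
  rewrite (JB _ ltr01 (causalZ 2 cJwf) cww) (JZ _ _ ltr01 cJwf) (J_J _ oP aP cwf).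
  rewrite (betaC alpha 1) (betaC alpha (1 - alpha)) -/be.
  have -> : alpha + (1 - alpha) = 1 by ring.
  have -> : alpha + 1 = 1 + alpha by ring.
  ring.
move=> r s rs; rewrite -(ler_pM2l be0) -!JFE.
exact: (J_homo a0 cF F_homo).
Qed.

End scalar.
End lyapunov.

(** * Gronwall inequality and Volterra trajectories *)

Section gronwall.
Context {R : realType}.
Notation mu := (@lebesgue_measure R).
Implicit Types (p q t s r a b m e c : R) (f g h V : R -> R).

Lemma powR_le_expR q r : 0 < q <= 1 -> 0 <= r -> r `^ q <= expR r.
Proof.
move=> /andP[q0 q1] r0; have [r1|r1] := leP r 1.
  have : r `^ q <= 1 `^ q by rewrite ge0_ler_powR// ?nnegrE// ltW.
  by rewrite powR1 => /le_trans; apply; rewrite -expR0 ler_expR.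
apply: (le_trans (ler1_powR (ltW r1) q1)).
by apply: le_trans (expR_ge1Dx r); rewrite lerDr.
Qed.

Lemma causal_expR c : causal (fun s => expR (c * s) * chi 0 s).
Proof.
split=> [|s s0|t].
- apply: measurable_funM; last exact: measurable_indic.
  by apply: measurableT_comp => //; exact: measurable_funM.
- by rewrite chiE leNgt s0 mulr0.
exists (expR (`|c| * `|t|)) => s st; rewrite chiE normrM ger0_norm ?expR_ge0//.
have [s0|s0] := leP 0 s; last by rewrite normr0 mulr0 expR_ge0.
rewrite normr1 mulr1 ler_expR (le_trans (ler_norm _))// normrM ler_wpM2l//.
by rewrite !ger0_norm ?(le_trans s0).
Qed.

(** The weight exp(- c r) is bounded by (c r)^(- p / 2), which leaves an
    integrable kernel and gains a negative power of [c]. *)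
Lemma J_expR_le p c t : 0 < p <= 1 -> 0 < c -> 0 <= t ->
  J p (fun s => expR (c * s) * chi 0 s) t <=
  expR (c * t) * (c `^ (p / 2))^-1 * (t `^ (p / 2) / (p / 2)).
Proof.
move=> p01 c0 t0; have [p0 p1] : 0 < p /\ p <= 1 by case/andP: p01.
have p20 : 0 < p / 2 by rewrite divr_gt0.
have p21 : p / 2 <= 1 by lra.
rewrite -J_chi// -JZ//; last exact: causal_chi.
rewrite !JE; apply: le_Rintegral => //.
- exact: (integrable_ker t p0 (causal_expR c)).
- exact: (integrable_ker t p20 (causalZ _ causal_chi)).
move=> s _; rewrite !mulrA ler_wpM2r//.
have [ts|st] := leP t s; first by rewrite !ker_le0 ?mul0r// subr_le0.
have r0 : 0 < t - s by rewrite subr_gt0.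
rewrite !kerE//; set r := t - s in r0 *.
have -> : expR (c * s) = expR (c * t) * expR (- (c * r)).
  by rewrite -expRD; congr expR; rewrite /r; ring.
have -> : r `^ (p - 1) = r `^ (p / 2) * r `^ (p / 2 - 1).
  rewrite -powRD ?(gt_eqF r0) ?implybT//; congr (_ `^ _).
  by field.
rewrite expRN ler_pdivlMr ?powR_gt0//.
have -> : forall x y z u v : R, x * y * (z * u^-1) * v = y * z * (v * x / u).
  by move=> *; ring.
rewrite ler_piMr ?mulr_ge0 ?powR_ge0 ?expR_ge0// ler_pdivrMr ?expR_gt0// mul1r.
rewrite -powRM ?(ltW r0) ?(ltW c0)//.
apply: powR_le_expR; first by rewrite p20.
by rewrite mulr_ge0// ltW.
Qed.

(** Let W be the supremum of V(t) exp(- c t). Weighting the inequality by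
    exp(- c t), with [c] so large that lam J (exp (c s)) <= exp(c t) / 2, gives
    W <= const + W / 2. *)
Lemma fractional_gronwall p lam T : 0 < p <= 1 -> 0 <= lam -> 0 < T ->
  exists2 C : R, 0 < C & forall V a b, causal V -> (forall s, 0 <= V s) ->
    0 <= a -> 0 <= b ->
    (forall t, 0 <= t <= T ->
       V t <= a + J p (fun s => lam * V s + b * chi 0 s) t) ->
    forall t, 0 <= t <= T -> V t <= C * (a + b).
Proof.
move=> p01 l0 T0; have [p0 p1] : 0 < p /\ p <= 1 by case/andP: p01.
pose K := T `^ (p / 2) / (p / 2).
have p20 : 0 < p / 2 by rewrite divr_gt0.
have K0 : 0 <= K by rewrite divr_ge0 ?powR_ge0// ltW.
(* D = c^(p / 2) is the gain from the weight; it makes lam K / D <= 1 / 2. *)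
pose D := 1 + 2 * lam * K.
have D0 : 0 < D by rewrite ltr_pwDl// mulr_ge0// mulr_ge0.
pose c := D `^ (p / 2)^-1.
have c0 : 0 < c by rewrite powR_gt0.
have cD : c `^ (p / 2) = D.
  by rewrite -powRrM mulVf ?gt_eqF// powRr1// ltW.
pose L := T `^ p / p; have L0 : 0 <= L by rewrite divr_ge0 ?powR_ge0// ltW.
pose E := expR (c * T).
have E1 : 0 < E by rewrite expR_gt0.
exists (2 * E * (1 + L)); first by rewrite !mulr_gt0// ltr_pwDl.
move=> V a b cV V0 a0 b0 HV.
pose S := [set V t * expR (- (c * t)) | t in `[0, T]%classic].
have [M M0 HM] := causal_le T cV.
have S0 : S (V 0 * expR (- (c * 0))).
  by exists 0 => //=; rewrite in_itv/= lexx ltW.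
have hS : has_sup S.
  split; first by exists (V 0 * expR (- (c * 0))).
  exists M; move=> y [t /=]; rewrite in_itv/= => /andP[t0 tT] <-.
  rewrite -[leRHS]mulr1 ler_pM ?expR_ge0//.
    by have := HM t tT; rewrite chiE t0 mulr1; apply: le_trans; exact: ler_norm.
  by rewrite expR_le1 oppr_le0 mulr_ge0// ltW.
pose W := sup S.
have VW t : 0 <= t <= T -> V t <= W * expR (c * t).
  move=> tT; have : S (V t * expR (- (c * t))) by exists t => //=; rewrite in_itv.
  move=> /(ub_le_sup hS.2); rewrite -/W => H.
  by rewrite -ler_pdivrMr ?expR_gt0// -expRN.
have W0 : 0 <= W.
  by apply: (le_trans _ (ub_le_sup hS.2 S0)); rewrite mulr_ge0 ?expR_ge0.
have cc := @causal_chi R; have ce := causal_expR c.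
have main t : 0 <= t <= T -> V t <= (a + b * L) + W / 2 * expR (c * t).
  move=> /andP[t0 tT]; have tT' : 0 <= t <= T by rewrite t0.
  apply: (le_trans (HV t tT')).
  rewrite (JD _ p0 (causalZ lam cV) (causalZ b cc)) (JZ b _ p0 cc) J_chi//.
  rewrite (JZ lam _ p0 cV) -addrA lerD2l addrC lerD//; last first.
    rewrite ler_wpM2l// ler_wpM2r ?invr_ge0 ?(ltW p0)//.
    by rewrite ge0_ler_powR// ?nnegrE ?(ltW p0) ?(ltW T0).
  have H1 : J p V t <= W * J p (fun s => expR (c * s) * chi 0 s) t.
    rewrite -(JZ W _ p0 ce); apply: J_le => //; first exact: causalZ.
    move=> s /andP[s0 st]; rewrite chiE s0 mulr1 VW// s0/=.
    by rewrite (le_trans (ltW st)).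
  have H2 := J_expR_le p01 c0 t0.
  have H3 : t `^ (p / 2) / (p / 2) <= K.
    rewrite ler_wpM2r ?invr_ge0 ?(ltW p20)//.
    by rewrite ge0_ler_powR// ?nnegrE ?(ltW p20) ?(ltW T0).
  have H4 : lam * K / D <= 1 / 2.
    by rewrite ler_pdivrMr// /D; lra.
  rewrite cD in H2.
  have H5 : J p (fun s => expR (c * s) * chi 0 s) t <= expR (c * t) * D^-1 * K.
    apply: (le_trans H2); rewrite ler_wpM2l// mulr_ge0 ?expR_ge0//.
    by rewrite invr_ge0 ltW.
  apply: (@le_trans _ _ (lam * (W * (expR (c * t) * D^-1 * K)))).
    by rewrite ler_wpM2l// (le_trans H1)// ler_wpM2l.
  have -> : lam * (W * (expR (c * t) * D^-1 * K)) = W * expR (c * t) * (lam * K / D) by ring.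
  have -> : W / 2 * expR (c * t) = W * expR (c * t) * (1 / 2) by ring.
  by rewrite ler_wpM2l// mulr_ge0 ?expR_ge0.
have Wle : W <= (a + b * L) + W / 2.
  apply: ge_sup; first by exists (V 0 * expR (- (c * 0))).
  move=> y [t /=]; rewrite in_itv/= => tT <-; have /andP[t0 _] := tT.
  rewrite expRN ler_pdivrMr ?expR_gt0// (le_trans (main t tT))//.
  rewrite mulrDl lerD2r ler_peMr//; first by rewrite addr_ge0// mulr_ge0.
  by rewrite -expR0 ler_expR mulr_ge0// ltW.
have W2 : W <= 2 * (a + b * L) by lra.
move=> t tT; apply: (le_trans (VW t tT)).
have : expR (c * t) <= E by rewrite ler_expR ler_wpM2l ?(ltW c0)//; case/andP: tT.
move=> tE; apply: (@le_trans _ _ (W * E)); first by rewrite ler_wpM2l.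
apply: (@le_trans _ _ (2 * (a + b * L) * E)); first by rewrite ler_wpM2r// ltW.
have -> : 2 * (a + b * L) * E = 2 * E * (a + b * L) by ring.
rewrite -[leRHS]mulrA ler_wpM2l ?mulr_ge0 ?(ltW E1)//.
have : 0 <= a * L by rewrite mulr_ge0.
lra.
Qed.

End gronwall.

Section euclid.
Context {R : realType} {n : nat}.
Implicit Types (x y z : 'rV[R]_n) (a : R).

Lemma dotvC x y : dotv x y = dotv y x.
Proof. by apply: eq_bigr => i _; rewrite mulrC. Qed.

Lemma dotvDl x y z : dotv (x + y) z = dotv x z + dotv y z.
Proof. by rewrite /dotv -big_split; apply: eq_bigr => i _; rewrite mxE mulrDl. Qed.

Lemma dotvZl a x y : dotv (a *: x) y = a * dotv x y.
Proof. by rewrite /dotv mulr_sumr; apply: eq_bigr => i _; rewrite mxE mulrA. Qed.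

Lemma dotvDr x y z : dotv x (y + z) = dotv x y + dotv x z.
Proof. by rewrite dotvC dotvDl !(dotvC x). Qed.

Lemma dotvZr a x y : dotv x (a *: y) = a * dotv x y.
Proof. by rewrite dotvC dotvZl dotvC. Qed.

Lemma dotvNl x y : dotv (- x) y = - dotv x y.
Proof. by rewrite -scaleN1r dotvZl mulN1r. Qed.

Lemma dotvNr x y : dotv x (- y) = - dotv x y.
Proof. by rewrite dotvC dotvNl dotvC. Qed.

Lemma dotvBl x y z : dotv (x - y) z = dotv x z - dotv y z.
Proof. by rewrite dotvDl dotvNl. Qed.

Lemma dotvBr x y z : dotv x (y - z) = dotv x y - dotv x z.
Proof. by rewrite dotvDr dotvNr. Qed.

Lemma dotvx0 x : dotv x 0 = 0.
Proof. by rewrite -(scale0r (0 : 'rV[R]_n)) dotvZr mul0r. Qed.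

Lemma enorm0 : enorm (0 : 'rV[R]_n) = 0.
Proof. by rewrite /enorm dotvx0 sqrtr0. Qed.

Lemma dotvv_ge0 x : 0 <= dotv x x.
Proof. by apply: sumr_ge0 => i _; rewrite -expr2 sqr_ge0. Qed.

Lemma sqr_enorm x : enorm x ^+ 2 = dotv x x.
Proof. by rewrite sqr_sqrtr// dotvv_ge0. Qed.

Lemma enorm_ge0 x : 0 <= enorm x.
Proof. exact: sqrtr_ge0. Qed.

Lemma enormN x : enorm (- x) = enorm x.
Proof. by rewrite /enorm dotvNl dotvNr opprK. Qed.

Lemma enormB x y : enorm (x - y) = enorm (y - x).
Proof. by rewrite -enormN opprB. Qed.

Lemma coord_le_enorm x i : `|x 0 i| <= enorm x.
Proof.
rewrite -(ler_pXn2r (ltn0Sn 1)) ?nnegrE ?enorm_ge0// sqr_enorm.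
rewrite real_normK ?num_real// /dotv (bigD1 i)//= -expr2 lerDl.
by apply: sumr_ge0 => j _; rewrite -expr2 sqr_ge0.
Qed.

Lemma cauchy_schwarz x y : dotv x y <= enorm x * enorm y.
Proof.
have [a0|a0] := eqVneq (enorm x) 0.
  rewrite a0 mul0r /dotv big1// => i _.
  have := coord_le_enorm x i; rewrite a0 normr_le0 => /eqP ->.
  by rewrite mul0r.
have [b0|b0] := eqVneq (enorm y) 0.
  rewrite b0 mulr0 /dotv big1// => i _.
  have := coord_le_enorm y i; rewrite b0 normr_le0 => /eqP ->.
  by rewrite mulr0.
have {}a0 : 0 < enorm x by rewrite lt_neqAle eq_sym a0 enorm_ge0.
have {}b0 : 0 < enorm y by rewrite lt_neqAle eq_sym b0 enorm_ge0.
have := dotvv_ge0 (enorm y *: x - enorm x *: y).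
rewrite !(dotvBl, dotvBr, dotvZl, dotvZr) -!sqr_enorm (dotvC y x) => H.
rewrite -(ler_pM2l (mulr_gt0 a0 b0)).
by move: H; set a := enorm x; set b := enorm y; set d := dotv x y; nra.
Qed.

Lemma enormD x y : enorm (x + y) <= enorm x + enorm y.
Proof.
rewrite -(ler_pXn2r (ltn0Sn 1)) ?nnegrE ?addr_ge0 ?enorm_ge0//.
rewrite sqr_enorm dotvDl !dotvDr -!sqr_enorm (dotvC y x).
by have := cauchy_schwarz x y; nra.
Qed.

Lemma enorm_le_coord x a : (forall i, `|x 0 i| <= a) -> enorm x <= n%:R * a.
Proof.
move=> xa; have [->|i0] := pselect (x = 0).
  rewrite /enorm /dotv big1 ?sqrtr0; last by move=> i _; rewrite mxE mul0r.
  case: n x xa => [|m] x xa; first by rewrite mul0r.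
  by rewrite mulr_ge0// (le_trans _ (xa ord0)).
case: n x xa i0 => [|m] x xa i0; first by exfalso; apply: i0; apply/rowP => -[].
have a0 : 0 <= a by rewrite (le_trans _ (xa ord0)).
rewrite -(ler_pXn2r (ltn0Sn 1)) ?nnegrE ?mulr_ge0 ?sqrtr_ge0//.
rewrite sqr_sqrtr; last by apply: sumr_ge0 => i _; rewrite -expr2 sqr_ge0.
rewrite exprMn; apply: (@le_trans _ _ (\sum_(i < m.+1) a ^+ 2)).
  apply: ler_sum => i _; rewrite -expr2 -real_normK ?num_real//.
  by rewrite ler_sqr ?nnegrE.
rewrite sumr_const card_ord -[leLHS]mulr_natl ler_wpM2r ?sqr_ge0//.
by rewrite expr2 ler_peMr// ler1n.
Qed.

Lemma norm_le_enorm x : `|x| <= enorm x.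
Proof.
rewrite [leLHS]/Num.norm /= mx_normrE; apply/bigmax_leP; split.
  exact: enorm_ge0.
by move=> [i j] _ /=; rewrite ord1; exact: coord_le_enorm.
Qed.

Lemma enorm_le_norm x : enorm x <= n%:R * `|x|.
Proof.
apply: enorm_le_coord => i.
rewrite [leRHS]/Num.norm /= mx_normrE; apply/bigmax_geP; right.
by exists (0, i).
Qed.

End euclid.

Section trajectory.
Context {R : realType} {n : nat}.
Implicit Types (p t s r a b c M : R) (z : 'rV[R]_n) (f : R -> 'rV[R]_n).

Lemma causal_sum m (g : 'I_m -> R -> R) : (forall i, causal (g i)) ->
  causal (fun s => \sum_(i < m) g i s).
Proof.
move=> cg; have -> : (fun s => \sum_(i < m) g i s) =
    (fun s => \sum_(i <- index_enum 'I_m) g i s) by [].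
elim: (index_enum _) => [|i r IH].
  under eq_fun do rewrite big_nil.
  by have := causalZ 0 (@causal_chi R); under eq_fun do rewrite mul0r.
by under eq_fun do rewrite big_cons; exact: causalD.
Qed.

Lemma J_sum m p (g : 'I_m -> R -> R) t : 0 < p -> (forall i, causal (g i)) ->
  J p (fun s => \sum_(i < m) g i s) t = \sum_(i < m) J p (g i) t.
Proof.
move=> p0; elim: m g => [g cg|m IH g cg].
  rewrite big_ord0 -[RHS](mul0r (J p (chi 0) t)) -JZ//; last exact: causal_chi.
  by congr (J p _ t); apply/funext => s; rewrite big_ord0 mul0r.
rewrite big_ord_recl -IH// -JD//; last exact: causal_sum.
by congr (J p _ t); apply/funext => s; rewrite big_ord_recl.
Qed.

Definition vcausal f := forall i, causal (fun s => f s 0 i).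

(** The solution of the Volterra equation with forcing [f]; [rho] collects the
    constants coming from the Gamma function. *)
Definition traj (rho p : R) z f t : 'rV[R]_n :=
  z + rho *: \row_i J p (fun s => f s 0 i) t.

Lemma trajE rho p z f t i :
  traj rho p z f t 0 i = z 0 i + rho * J p (fun s => f s 0 i) t.
Proof. by rewrite !mxE. Qed.

Lemma trajB rho p z1 z2 f1 f2 t : 0 < p -> vcausal f1 -> vcausal f2 ->
  traj rho p z1 f1 t - traj rho p z2 f2 t =
  traj rho p (z1 - z2) (fun s => f1 s - f2 s) t.
Proof.
move=> p0 c1 c2; apply/rowP => i; rewrite trajE !mxE.
have -> : (fun s => (f1 s - f2 s) 0 i) = (fun s => f1 s 0 i - f2 s 0 i).
  by apply/funext => s; rewrite !mxE.
by rewrite (JB _ p0 (c1 i) (c2 i)); ring.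
Qed.

Lemma traj_holder rho p z f s t M : 0 < p <= 1 -> 0 <= rho -> vcausal f ->
  s <= t -> (forall r, r <= t -> enorm (f r) <= M) ->
  enorm (traj rho p z f t - traj rho p z f s) <=
  n%:R * (rho * (2 * M / p)) * (t - s) `^ p.
Proof.
move=> p01 r0 cf st fM; rewrite -mulrA; apply: enorm_le_coord => i.
have -> : (traj rho p z f t - traj rho p z f s) 0 i =
    rho * (J p (fun s => f s 0 i) t - J p (fun s => f s 0 i) s).
  by rewrite mxE [X in _ + X]mxE !trajE; ring.
rewrite normrM (ger0_norm r0) -mulrA ler_wpM2l//.
apply: J_holder => // r rt; apply: le_trans (fM r rt); exact: coord_le_enorm.
Qed.

Lemma causal_dotv_traj rho p z f : 0 < p <= 1 -> vcausal f ->
  causal (fun s => dotv (traj rho p z f s) (f s)).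
Proof.
move=> p01 cf; apply: causal_sum => i.
have -> : (fun s => traj rho p z f s 0 i * f s 0 i) =
    (fun s => z 0 i * f s 0 i + rho * (J p (fun s => f s 0 i) s * f s 0 i)).
  by apply/funext => s; rewrite trajE; ring.
apply: causalD; apply: causalZ => //; apply: causalM => //.
exact: causal_J.
Qed.

Lemma traj_lyapunov rho p z f t : 0 < p < 1 -> 0 <= rho -> vcausal f -> 0 <= t ->
  enorm (traj rho p z f t) ^+ 2 <= enorm z ^+ 2 +
    2 * rho * J p (fun s => dotv (traj rho p z f s) (f s)) t.
Proof.
move=> /andP[p0 p1] r0 cf t0; have p01 : 0 < p <= 1 by rewrite p0 ltW.
have cJf i : causal (fun s => J p (fun s => f s 0 i) s * f s 0 i).
  by apply: causalM => //; exact: causal_J.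
have c1 i : causal (fun s => z 0 i * f s 0 i) by exact: causalZ.
have c2 i : causal (fun s => rho * (J p (fun s => f s 0 i) s * f s 0 i)).
  exact: causalZ.
have -> : (fun s => dotv (traj rho p z f s) (f s)) = (fun s =>
    \sum_(i < n) (z 0 i * f s 0 i + rho * (J p (fun s => f s 0 i) s * f s 0 i))).
  by apply/funext => s; apply: eq_bigr => i _; rewrite trajE; ring.
rewrite J_sum//; last by move=> i; exact: causalD.
rewrite !sqr_enorm /dotv mulr_sumr -big_split/=; apply: ler_sum => i _.
rewrite (JD _ p0 (c1 i) (c2 i)) !JZ// trajE.
have p01' : 0 < p < 1 by rewrite p0.
have H := sqr_J_le p01' (cf i) t0.
have : rho ^+ 2 * J p (fun s => f s 0 i) t ^+ 2 <=
   rho ^+ 2 * (2 * J p (fun s => J p (fun s => f s 0 i) s * f s 0 i) t).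
  by rewrite ler_wpM2l// sqr_ge0.
lra.
Qed.

(** The Lyapunov inequality combined with Gronwall's lemma. *)
Lemma traj_bound rho p lam T : 0 < p < 1 -> 0 <= rho -> 0 <= lam -> 0 < T ->
  exists2 C : R, 0 < C & forall z f b, vcausal f -> 0 <= b ->
    (forall s, 0 <= s < T -> dotv (traj rho p z f s) (f s) <=
        lam * enorm (traj rho p z f s) ^+ 2 + b) ->
    forall t, 0 <= t <= T ->
      enorm (traj rho p z f t) ^+ 2 <= C * (enorm z ^+ 2 + b).
Proof.
move=> p01 r0 l0 T0; have [p0 p1] : 0 < p /\ p < 1 by case/andP: p01.
have p01' : 0 < p <= 1 by rewrite p0 ltW.
have l0' : 0 <= 2 * rho * lam by rewrite !mulr_ge0.
have [C C0 HC] := fractional_gronwall p01' l0' T0.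
exists (C * (1 + 2 * rho)); first by rewrite mulr_gt0// ltr_pwDl// mulr_ge0.
move=> z f b cf b0 Hf t tT.
pose V s := enorm (traj rho p z f s) ^+ 2 * chi 0 s.
have cc := @causal_chi R.
have cV : causal V.
  have cx i : causal (fun s => z 0 i * chi 0 s + rho * J p (fun s => f s 0 i) s).
    by apply: causalD; apply: causalZ => //; exact: causal_J.
  have := causal_sum (fun i => causalM (cx i) (cx i)).
  congr causal; apply/funext => s; rewrite /V sqr_enorm /dotv mulr_suml.
  apply: eq_bigr => i _; rewrite trajE chiE; have [s0|s0] := leP 0 s.
    by rewrite /= !mulr1.
  by rewrite J_neg ?(ltW s0)// !mulr0 addr0 mulr0.
have VE s : 0 <= s -> V s = enorm (traj rho p z f s) ^+ 2.
  by move=> s0; rewrite /V chiE s0 mulr1.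
have A0 : 0 <= enorm z ^+ 2 by exact: sqr_ge0.
have b0' : 0 <= 2 * rho * b by rewrite !mulr_ge0.
have V0 s : 0 <= V s by rewrite /V mulr_ge0 ?sqr_ge0// chiE.
have := HC V (enorm z ^+ 2) (2 * rho * b) cV V0 A0 b0'.
move=> /(_ _ t tT); rewrite VE; last by case/andP: tT.
move=> H; apply: (le_trans (H _)); last first.
  rewrite -[leRHS]mulrA ler_wpM2l ?(ltW C0)//.
  have : 0 <= 2 * rho * enorm z ^+ 2 by rewrite mulr_ge0// mulr_ge0.
  by move: b0; lra.
move=> {tT H}t /andP[t0 tT]; rewrite VE//.
apply: (le_trans (traj_lyapunov z p01 r0 cf t0)).
rewrite lerD2l.
have cd := causal_dotv_traj rho z p01' cf.
have c3 : causal (fun s => lam * V s + b * chi 0 s).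
  by apply: causalD; apply: causalZ.
apply: (@le_trans _ _ (2 * rho * J p (fun s => lam * V s + b * chi 0 s) t)).
  rewrite ler_wpM2l ?mulr_ge0//; apply: J_le => // s /andP[s0 st].
  by rewrite VE// chiE s0 mulr1 Hf// s0 (lt_le_trans st).
rewrite -JZ//; apply: J_le => //.
- exact: causalZ.
- by apply: causalD; apply: causalZ.
by move=> s _; lra.
Qed.

End trajectory.

(** * Lebesgue and Borel measurability, the Gamma function *)

Section completed.
Context {R : realType}.
Notation mu := (@lebesgue_measure R).
Notation cmu := (@completed_lebesgue_measure R).

Lemma measurable_id_lebesgue :
  measurable_fun setT (id : lebesgueType R -> measurableTypeR R).
Proof. by move=> _ A mA; rewrite setTI; exact: sub_caratheodory. Qed.

Lemma measurable_fun_lebesgue d (T : measurableType d) (D : set R) (f : R -> T) :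
  measurable (D : set (measurableTypeR R)) ->
  measurable_fun (D : set (measurableTypeR R)) f ->
  measurable_fun (D : set (lebesgueType R)) (f : lebesgueType R -> T).
Proof.
by move=> mD mf _ A mA; apply: sub_caratheodory; exact: mf.
Qed.

Lemma ge0_integral_lebesgue (D : set R) (f : R -> \bar R) :
  measurable (D : set (measurableTypeR R)) ->
  measurable_fun (D : set (measurableTypeR R)) f -> (forall x, D x -> 0 <= f x)%E ->
  (\int[cmu]_(x in D) f x = \int[mu]_(x in D) f x)%E.
Proof.
move=> mD mf f0.
pose M := measure_function_pushforward__canonical__measure_function_Measure
  cmu measurable_id_lebesgue.
transitivity (\int[M]_(x in D) f x)%E; last first.
  by apply: eq_measure_integral => //= A mA _.
have f0' : {in D, forall y, (0 <= f y)%E} by move=> y /set_mem; exact: f0.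
exact: esym (ge0_integral_pushforward measurable_id_lebesgue cmu mD mf f0').
Qed.

Lemma integral_lebesgue (D : set R) (f : R -> \bar R) :
  measurable (D : set (measurableTypeR R)) ->
  measurable_fun (D : set (measurableTypeR R)) f ->
  (\int[cmu]_(x in D) f x = \int[mu]_(x in D) f x)%E.
Proof.
move=> mD mf; rewrite integralE [RHS]integralE.
by congr (_ - _)%E; apply: ge0_integral_lebesgue => //;
  [exact: measurable_funepos|exact: measurable_funeneg].
Qed.

(** The sigma-algebra of Lebesgue measurable sets is the completion of that of
    the Borel sets. *)
Lemma measurable_completed (A : set R) :
  measurable (A : set (lebesgueType R)) ->
  exists X N : set R, [/\ measurable (X : set (measurableTypeR R)),
    measurable (N : set (measurableTypeR R)), mu N = 0 & X `<=` A /\ A `<=` X `|` N].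
Proof.
move=> mA.
have : (completed_algebra_gen mu).-sigma.-measurable A.
  by rewrite completed_caratheodory_measurable.
rewrite g_sigma_completed_algebra_genE => -[X mX [M [N [mN N0 MN]]] <-].
exists X, N; split=> //; split=> [x Xx|x [Xx|Mx]]; [by left|by left|right].
exact: MN.
Qed.

Lemma ae_lebesgue (P : R -> Prop) : {ae cmu, forall x, P x} ->
  exists N : set R, [/\ measurable (N : set (measurableTypeR R)), mu N = 0 &
    forall x, ~ N x -> P x].
Proof.
move=> [B [mB B0 PB]]; have [X [N [mX mN N0 [XB BXN]]]] := measurable_completed mB.
exists (X `|` N); split.
- exact: measurableU.
- apply/eqP; rewrite eq_le measure_ge0 andbT.
  rewrite (le_trans (measureU2 _ _ _))//= N0 adde0 -B0.
  apply: (@le_measure _ (lebesgueType R) _ cmu) => //; rewrite inE//.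
  exact: sub_caratheodory.
- move=> x XNx; apply: contrapT => Px; apply: XNx; apply: BXN; exact: PB.
Qed.

(** Each sublevel set at a rational level is a Borel set up to a null set; [f] is
    Borel measurable off the union of these countably many null sets. *)
Lemma borel_version (D : set R) (f : R -> R) :
  measurable (D : set (measurableTypeR R)) ->
  measurable_fun (D : set (lebesgueType R)) (f : lebesgueType R -> R) ->
  exists N : set R, [/\ measurable (N : set (measurableTypeR R)), mu N = 0 &
   measurable_fun (D `\` N : set (measurableTypeR R)) f].
Proof.
move=> mD mf.
have mDl : measurable (D : set (lebesgueType R)) by exact: sub_caratheodory.
pose L (q : rat) := D `&` (f @^-1` `]-oo, ratr q[%classic).
have H (q : rat) : exists XN : set R * set R,
    [/\ measurable (XN.1 : set (measurableTypeR R)),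
    measurable (XN.2 : set (measurableTypeR R)), mu XN.2 = 0 &
    XN.1 `<=` L q /\ L q `<=` XN.1 `|` XN.2].
  have [|X [N HXN]] := @measurable_completed (L q).
    by apply: mf => //; exact: measurable_itv.
  by exists (X, N).
have [XN HXN] := choice H.
(* The rationals are numbered by pickle to have a countable union over nat. *)
pose NN (k : nat) : set R := if unpickle k is Some q then (XN q).2 else set0.
pose N := \bigcup_k NN k.
have mNN k : measurable (NN k : set (measurableTypeR R)).
  by rewrite /NN; case: (unpickle k) => // q; case: (HXN q).
have mN : measurable (N : set (measurableTypeR R)) by exact: bigcupT_measurable.
exists N; split=> //.
  apply/(@negligibleP _ _ _ mu N) => //; apply: negligible_bigcup => k.
  apply/negligibleP => //; rewrite /NN; case: (unpickle k) => [q|]; last exact: measure0.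
  by case: (HXN q).
apply: (measurability _ (RGenInftyO.measurableE R)) => _ [_ [r ->] <-].
rewrite (_ : _ `&` _ = \bigcup_(q in [set: rat]) (if ratr q < r then (XN q).1 `\` N else set0)).
  apply: bigcupT_measurable_rat => q; case: ifP => // _.
  by apply: measurableD => //; case: (HXN q).
apply/seteqP; split=> [x [[Dx Nx]]|x [q _]].
  rewrite /= in_itv/= => xr; have [q] := rat_in_itvoo xr.
  rewrite in_itv/= => /andP[xq qr].
  exists q => //; rewrite qr; split=> //.
  have [_ _ _ [_ /(_ x)]] := HXN q.
  case; first by split=> //=; rewrite in_itv.
    by [].
  move=> Nq; exfalso; apply: Nx.
    have Nq' : NN (pickle q) x by rewrite /NN pickleK.
    exact: (bigcup_sup (i := pickle q) I Nq').
case: ifP => // qr [Xx Nx].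
have [_ _ _ [/(_ x Xx)[Dx /=]]] := HXN q.
rewrite in_itv/= => xq _; split; first by split.
by rewrite /= in_itv/= (lt_trans xq).
Qed.

End completed.

Section gamma.
Context {R : realType}.
Notation mu := (@lebesgue_measure R).

(** Finiteness is the point: an infinite integral would make [Gamma a] zero. The
    integrand is at most t^(a - 1) on ]0, 1] and exp(- t) beyond, and at least
    exp(- 1) on ]0, 1]. *)
Lemma Gamma_gt0 (a : R) : 0 < a <= 1 -> 0 < Gamma a.
Proof.
move=> /andP[a0 a1].
pose h (t : R) := t `^ (a - 1) * expR (- t).
have mh D : measurable_fun (D : set (measurableTypeR R)) h.
  apply: measurable_funTS; apply: measurable_funM; first exact: measurable_powR.
  by apply: measurableT_comp => //; exact: measurableT_comp.
have h0 t : 0 <= h t by rewrite mulr_ge0 ?powR_ge0 ?expR_ge0.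
have mI : measurable (`]0, +oo[%classic : set (measurableTypeR R)) by exact: measurable_itv.
rewrite /Gamma /Rintegral integral_lebesgue//; last first.
  by apply/measurable_EFinP; exact: mh.
apply: fine_gt0; apply/andP; split.
  apply: (@lt_le_trans _ _ (\int[mu]_(t in `]0%R, 1%R]) (expR (- 1))%:E)%E).
    rewrite integral_cst//= lebesgue_measure_itv/= lte_fin ltr01.
    by rewrite -EFinD -EFinM lte_fin subr0 mulr1 expR_gt0.
  apply: (@le_trans _ _ (\int[mu]_(t in `]0%R, 1%R]) (h t)%:E)%E).
    apply: ge0_le_integral => //.
    - by apply/measurable_EFinP; exact: mh.
    move=> t /=; rewrite in_itv/= lee_fin => /andP[t0 t1].
    rewrite -[leLHS]mul1r ler_pM ?expR_ge0 ?ler_expR ?lerN2//.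
    by have := @ker_ge1 _ a t; rewrite kerE// a0 a1 t0 t1; apply.
  apply: ge0_subset_integral => //.
  - by apply/measurable_EFinP; exact: mh.
  - by move=> t _; rewrite lee_fin h0.
  - by move=> t /=; rewrite !in_itv/= => /andP[-> _].
pose G1 (t : R) := t `^ (a - 1) * \1_(`]0, 1]%classic) t.
have mG1 : measurable_fun setT G1.
  by apply: measurable_funM => //; exact: measurable_powR.
have G10 t : 0 <= G1 t by rewrite mulr_ge0 ?powR_ge0.
have mG2 := @measurable_exponential_pdf R 1.
have G20 t := @exponential_pdf_ge0 R 1 ler01 t.
apply: (@le_lt_trans _ _ (\int[mu]_t (G1 t + exponential_pdf 1 t)%:E)%E).
  apply: (@le_trans _ _ (\int[mu]_(t in `]0%R, +oo[) (G1 t + exponential_pdf 1 t)%:E)%E).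
    apply: ge0_le_integral => //.
    - by move=> t _; rewrite lee_fin h0.
    - by apply/measurable_EFinP; exact: mh.
    - by apply: measurable_funTS; apply/measurable_EFinP; exact: measurable_funD.
    move=> t /=; rewrite in_itv/= andbT lee_fin => t0.
    rewrite exponential_pdfE ?(ltW t0)// mulN1r mul1r /G1 indicE mem_setE in_itv/= t0/=.
    have [t1|t1] := leP t 1.
      rewrite mulr1 (@le_trans _ _ (t `^ (a - 1)))//.
        by rewrite ler_piMr ?powR_ge0// expR_le1 oppr_le0 ltW.
      by rewrite lerDl expR_ge0.
    rewrite mulr0 add0r ler_piMl ?expR_ge0//.
    have pE : a - 1 = - (1 - a) by ring.
    rewrite pE powRN invf_le1 ?powR_gt0//.
    rewrite -[leLHS](powRr0 t); apply: ler_powR; first exact: ltW.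
    by rewrite subr_ge0.
  apply: ge0_subset_integral => //.
  - by apply/measurable_EFinP; exact: measurable_funD.
  - by move=> t _; rewrite lee_fin addr_ge0.
under eq_integral do rewrite EFinD.
rewrite ge0_integralD//.
- rewrite integral_exponential_pdf//.
  have -> : (\int[mu]_t (G1 t)%:E = \int[mu]_(t in `]0%R, 1%R]) (t `^ (a - 1))%:E)%E.
    rewrite [RHS]integral_mkcond; apply: eq_integral => t _.
    by rewrite patchE /G1 indicE; case: ifP => _; rewrite ?mulr1 ?mulr0.
  by rewrite integral_powR// -EFinD ltry.
- by move=> t _; rewrite lee_fin.
- exact/measurable_EFinP.
- by move=> t _; rewrite lee_fin.
- exact/measurable_EFinP.
Qed.

End gamma.

(** * Motions as Volterra trajectories *)

Section to_trajectory.
Context {R : realType}.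
Notation mu := (@lebesgue_measure R).
Notation cmu := (@completed_lebesgue_measure R).
Implicit Types (p t s T : R) (h : R -> R).

Lemma J_itv p h t : causal h -> J p h t = \int[mu]_(s in `[0, t]) (ker p (t - s) * h s).
Proof.
move=> [_ h0 _]; rewrite JE [RHS]Rintegral_mkcond; apply: eq_Rintegral => s _.
rewrite patchE mem_setE in_itv/=; have [s0|s0] := leP 0 s; last by rewrite h0// mulr0.
by have [st|ts] := leP s t => //=; rewrite ker_le0 ?mul0r// subr_le0 ltW.
Qed.

Lemma div_powR_ker p t s : 0 < p < 1 -> s <= t ->
  ((t - s) `^ (1 - p))^-1 = ker p (t - s).
Proof.
move=> /andP[p0 p1]; rewrite le_eqVlt => /predU1P[->|st].
  by rewrite subrr ker_le0// powR0 ?invr0// gt_eqF// subr_gt0.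
by rewrite kerE ?subr_gt0// -powRN opprB.
Qed.

Lemma RL_causal p h t : 0 < p < 1 -> causal h ->
  \int[cmu]_(s in `[0, t]) (h s / (t - s) `^ (1 - p)) = J p h t.
Proof.
move=> p01 ch; rewrite J_itv// /Rintegral -integral_lebesgue//.
  congr fine; apply: eq_integral => s; rewrite inE/= in_itv/= => /andP[_ st].
  by rewrite div_powR_ker// mulrC.
apply: measurable_funTS; apply/measurable_EFinP; apply: measurable_funM.
  exact: measurable_ker_sub.
by case: ch.
Qed.

Lemma ae_of_null (N : set R) (P : R -> Prop) :
  measurable (N : set (measurableTypeR R)) -> mu N = 0 ->
  (forall x, ~ N x -> P x) -> {ae cmu, forall x, P x}.
Proof.
move=> mN N0 NP; exists N; split => //; first exact: sub_caratheodory.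
by move=> x /= Px; apply: contrapT => /NP.
Qed.

(** Replacing a Lebesgue measurable, essentially bounded function by a bounded
    Borel function does not change its fractional integrals. *)
Lemma RL_borel (f : R -> R) T (M : R) :
  measurable_fun (`[0, T]%classic : set (lebesgueType R)) (f : lebesgueType R -> R) ->
  {ae cmu, forall t, 0 <= t <= T -> `|f t| <= M} ->
  exists h, [/\ causal h, forall t, T < t -> h t = 0 & forall p t, 0 < p < 1 ->
    0 <= t <= T -> \int[cmu]_(s in `[0, t]) (f s / (t - s) `^ (1 - p)) = J p h t].
Proof.
move=> mf /ae_lebesgue[N2 [mN2 N20 HN2]].
have mI : measurable (`[0, T]%classic : set (measurableTypeR R)) by exact: measurable_itv.
have [N1 [mN1 N10 HN1]] := borel_version mI mf.
pose N := N1 `|` N2.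
have mN : measurable (N : set (measurableTypeR R)) by exact: measurableU.
have N0 : mu N = 0.
  by apply/negligibleP => //; apply: negligibleU; apply/negligibleP.
have mD : measurable (`[0, T]%classic `\` N : set (measurableTypeR R)).
  exact: measurableD.
pose h : R -> R := f \_ (`[0, T] `\` N).
have ch : causal h.
  split=> [|s s0|t].
  - apply/(measurable_restrictT f mD).
    apply: measurable_funS HN1; first exact: measurableD.
    by move=> x [Ix NNx]; split=> // N1x; apply: NNx; left.
  - by rewrite /h patchE memNset// /= in_itv/= leNgt s0 => -[].
  exists `|M| => s _; rewrite /h patchE; case: ifPn; last by rewrite normr0.
  rewrite inE/= in_itv/= => -[sT Ns]; apply: (le_trans _ (ler_norm M)).
  by apply: HN2 => // N2s; apply: Ns; right.
exists h; split=> //.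
  by move=> t Tt; rewrite /h patchE memNset// /= in_itv/= [t <= T]leNgt Tt andbF => -[].
move=> p t p01 /andP[t0 tT]; rewrite -RL_causal// /Rintegral; congr fine.
have mk : measurable_fun (`[0, t]%classic : set (lebesgueType R))
    (fun s : lebesgueType R => ((t - s) `^ (1 - p))^-1).
  apply: measurable_fun_lebesgue; first exact: measurable_itv.
  rewrite (_ : (fun s => _) = fun s => (t - s) `^ (- (1 - p))); last first.
    by apply/funext => s; rewrite powRN.
  apply: measurable_funTS; apply: (measurableT_comp (measurable_powR _)).
  exact: measurable_funB.
have sub : (`[0, t] `<=` `[0, T])%classic.
  by move=> s /=; rewrite !in_itv/= => /andP[-> /le_trans]; apply.
have mtl : measurable (`[0, t]%classic : set (lebesgueType R)).
  by apply: sub_caratheodory; exact: measurable_itv.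
have mTl : measurable (`[0, T]%classic : set (lebesgueType R)).
  by apply: sub_caratheodory; exact: measurable_itv.
pose F1 (s : lebesgueType R) := (f s / (t - s) `^ (1 - p))%:E.
pose F2 (s : lebesgueType R) := (h s / (t - s) `^ (1 - p))%:E.
have mF1 : measurable_fun (`[0, t]%classic : set (lebesgueType R)) F1.
  apply/measurable_EFinP; apply: measurable_funM; last exact: mk.
  exact: measurable_funS mTl sub mf.
have mF2 : measurable_fun (`[0, t]%classic : set (lebesgueType R)) F2.
  apply/measurable_EFinP; apply: measurable_funM; last exact: mk.
  apply: measurable_fun_lebesgue; first exact: measurable_itv.
  by apply: measurable_funTS; case: ch.
have F12 : ae_eq cmu (`[0, t]%classic : set (lebesgueType R)) F1 F2.
  apply: (ae_of_null mN N0) => s Ns st.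
  by rewrite /F1 /F2 /h patchE mem_set//; split=> //; exact: sub.
have E := @ae_eq_integral _ _ _ cmu _ F2 F1 mtl mF1 mF2 F12.
exact E.
Qed.

Lemma J1_itv h t : causal h -> J 1 h t = \int[mu]_(s in `[0, t]) h s.
Proof.
move=> ch; have [mh h0 _] := ch.
have -> : \int[mu]_(s in `[0, t]) h s = \int[mu]_(s in `[0, t[) h s.
  rewrite /Rintegral integral_itv_bndo_bndc//.
  by apply: measurable_funTS; exact/measurable_EFinP.
rewrite JE [RHS]Rintegral_mkcond; apply: eq_Rintegral => s _.
rewrite patchE mem_setE in_itv/=; have [s0|s0] := leP 0 s; last by rewrite h0// mulr0.
have [st|ts] := ltP s t => /=; last by rewrite ker_le0 ?mul0r// subr_le0.
by rewrite kerE ?subr_gt0// subrr powRr0 mul1r.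
Qed.

Lemma J1_derivative h T : causal h -> (forall t, T < t -> h t = 0) ->
  {ae mu, forall t, 0 < t -> derivable (J 1 h) t 1 /\ derive1 (J 1 h) t = h t}.
Proof.
move=> ch hT; have [mh h0 _] := ch.
have ih : mu.-integrable setT (EFin \o h).
  have := integrable_ker (T + 1) ltr01 ch.
  congr (mu.-integrable setT _); apply/funext => s /=.
  have [st|ts] := ltP s (T + 1); first by rewrite kerE ?subr_gt0// subrr powRr0 mul1r.
  by rewrite hT ?mulr0//; lra.
have := @FTC1 R h (BLeft 0).
have -> : (fun x => (\int[mu]_(t in [set` Interval (BLeft 0) (BRight x)]) h t)%R) = J 1 h.
  by apply/funext => x; rewrite J1_itv.
move=> /(_ _ (open_integrable_locally openT ih)) H.
have iy y : mu.-integrable `[0, y] (EFin \o h) by apply: integrableS ih.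
have F := ae_filter_ringOfSetsType mu.
apply: filterS (H iy) => x Hx x0.
by apply: Hx; rewrite lte_fin.
Qed.

Lemma measurable_coord n (i : 'I_n) :
  measurable_fun setT ((fun v : 'rV[R]_n => v 0 i) :
    g_sigma_algebraType (@open 'rV[R]_n) -> R).
Proof.
apply: (measurability _ (RGenInftyO.measurableE R)) => _ [_ [r ->] <-].
rewrite setTI; apply: sub_sigma_algebra.
apply: (@open_comp _ _ (fun v : 'rV[R]_n => v 0 i)); last exact: interval_open.
by move=> v _; exact: coord_continuous.
Qed.

Lemma ess_bounded n T (f : R -> 'rV[R]_n) : Linf T f ->
  exists M : R, {ae cmu, forall t, 0 <= t <= T -> enorm (f t) <= M}.
Proof.
move=> [_]; rewrite /Linf_norm unlock.
have -> : (0 < cmu setT)%E.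
  have : (mu `[0%R, 1%R]%classic <= cmu setT)%E.
    apply: (@le_measure _ (lebesgueType R) _ cmu) => //; rewrite inE//.
    by apply: sub_caratheodory; exact: measurable_itv.
  by apply: lt_le_trans; rewrite lebesgue_measure_itv/= lte_fin ltr01 -EFinD lte_fin subr0.
set e := ess_sup _ _ => e_fin.
have [M eM] : exists M : R, (e <= M%:E)%E.
  by case: e e_fin => [r _|//|_]; [exists r|exists 0; rewrite leNye].
exists M; have := ess_sup_ge cmu (abse \o (EFin \o ((fun t : R => enorm (f t)) \_ `[0, T]))).
apply: filterS => t /= /le_trans /(_ eM); rewrite lee_fin patchE => H tT.
move: H; rewrite mem_set; last by rewrite /= in_itv.
by rewrite ger0_norm ?sqrtr_ge0.
Qed.

(** This is 1 / Gamma(a), by Euler's formula for the beta function. *)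
Definition volterra_coef (a : R) := Gamma (1 - a) / beta (1 - a) a.

Lemma volterra_coef_gt0 a : 0 < a < 1 -> 0 < volterra_coef a.
Proof.
move=> /andP[a0 a1]; have [b0 b1] : 0 < 1 - a /\ 1 - a <= 1 by split; lra.
by rewrite divr_gt0 ?Gamma_gt0 ?beta_gt0 ?b0 ?b1 ?a0 ?ltW.
Qed.

(** Let w be the fractional integral of [phi] that gives [z - z0]. The Caputo
    integral of [z] is J (1 - alpha) w, a multiple of the primitive of [phi], so
    its derivative is that multiple of [phi] almost everywhere. *)
Lemma motion_traj n nu nv alpha T
  (g : R -> 'rV[R]_n -> 'rV[R]_nu -> 'rV[R]_nv -> 'rV[R]_n) z0 u v z :
  0 < alpha < 1 -> 0 < T -> is_motion alpha T g z0 u v z ->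
  exists (f : R -> 'rV[R]_n) (N : set R),
    [/\ vcausal f, measurable (N : set (measurableTypeR R)), mu N = 0,
      forall t, 0 <= t <= T -> z t = traj (volterra_coef alpha) alpha z0 f t &
      forall t, 0 < t < T -> ~ N t -> f t = g t (z t) (u t) (v t)].
Proof.
move=> a01 T0 [[phi Lphi Hz] Hc]; have [a0 a1] : 0 < alpha /\ alpha < 1 by case/andP: a01.
have [M HM] := ess_bounded Lphi.
have Hi (i : 'I_n) : exists h, [/\ causal h, forall t, T < t -> h t = 0 & forall p t, 0 < p < 1 ->
    0 <= t <= T -> \int[cmu]_(s in `[0, t]) (phi s 0 i / (t - s) `^ (1 - p)) = J p h t].
  apply: (@RL_borel (fun s => phi s 0 i) T M).
    by case: Lphi => mphi _; exact: (measurableT_comp (measurable_coord i) mphi).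
  have F := ae_filter_ringOfSetsType cmu.
  by apply: filterS HM => t H tT; apply: (le_trans (coord_le_enorm _ _)); exact: H.
have [h Hh] := choice Hi.
have ch i : causal (h i) by case: (Hh i).
have zE t i : 0 <= t <= T -> z t 0 i = z0 0 i + (Gamma alpha)^-1 * J alpha (h i) t.
  move=> tT; have := congr1 (fun v : 'rV_n => v 0 i) (Hz t tT).
  rewrite /RL_integral !mxE; case: (Hh i) => _ _ ->// <-; ring.
have z0E : z 0 = z0.
  apply/rowP => i; rewrite zE ?lexx ?ltW// J_neg//; by rewrite mulr0 addr0.
have [b0 b1] : 0 < 1 - alpha /\ 1 - alpha <= 1 by split; lra.
have aP : 0 < alpha <= 1 by rewrite a0 ltW.
have bP : 0 < 1 - alpha <= 1 by rewrite b0.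
(* z - z0 is 1 / Gamma(alpha) times J alpha h, and this is J 1 h times c after
   applying J (1 - alpha). *)
pose c := (Gamma alpha)^-1 * beta (1 - alpha) alpha.
have CE t i : 0 <= t <= T -> Caputo_integral alpha z t 0 i = c * J 1 (h i) t.
  move=> /andP[t0 tT]; rewrite mxE.
  transitivity (\int[cmu]_(s in `[0, t])
     (((Gamma alpha)^-1 * J alpha (h i) s) / (t - s) `^ (1 - (1 - alpha)))).
    apply: eq_Rintegral => s; rewrite inE/= in_itv/= => /andP[s0 st].
    rewrite subKr; congr (_ / _); rewrite z0E !mxE zE ?s0 ?(le_trans st)//; ring.
  rewrite (RL_causal (h := fun s => (Gamma alpha)^-1 * J alpha (h i) s)); last 2 first.
  - by apply/andP; split; lra.
  - by apply: causalZ; exact: causal_J.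
  by rewrite JZ//; [rewrite J_J// subrK /c mulrA|exact: causal_J].
have D : {ae mu, forall t, forall i : 'I_n, 0 < t ->
    derivable (J 1 (h i)) t 1 /\ derive1 (J 1 (h i)) t = h i t}.
  have F := ae_filter_ringOfSetsType mu.
  apply: filter_forall => i; apply: (@J1_derivative _ T) => //.
  by case: (Hh i).
have [N1 [mN1 N10 HN1]] := D.
have [N2 [mN2 N20 HN2]] := ae_lebesgue Hc.
pose f t := \row_i ((Gamma (1 - alpha))^-1 * c * h i t).
have fE i : (fun s => f s 0 i) = (fun s => (Gamma (1 - alpha))^-1 * c * h i s).
  by apply/funext => s; rewrite mxE.
exists f, (N1 `|` N2); split.
- by move=> i; rewrite fE; exact: causalZ.
- exact: measurableU.
- apply/negligibleP; first exact: measurableU.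
  by apply: negligibleU; apply/negligibleP.
- move=> t tT; apply/rowP => i; rewrite zE// trajE fE JZ// /volterra_coef /c.
  have G0 : Gamma alpha != 0 by rewrite gt_eqF ?Gamma_gt0.
  have G1 : Gamma (1 - alpha) != 0 by rewrite gt_eqF ?Gamma_gt0.
  have B0 : beta (1 - alpha) alpha != 0 by rewrite gt_eqF ?beta_gt0.
  by congr (_ + _); field; rewrite G0 G1 B0.
move=> t /andP[t0 tT] Nt.
have [dC <-] : derivable (Caputo_integral alpha z) t 1 /\
    Caputo alpha z t = g t (z t) (u t) (v t).
  by apply: HN2; [move=> N2t; apply: Nt; right|rewrite !ltW].
have HD i : derivable (J 1 (h i)) t 1 /\ derive1 (J 1 (h i)) t = h i t.
  have : forall i : 'I_n, 0 < t ->
      derivable (J 1 (h i)) t 1 /\ derive1 (J 1 (h i)) t = h i t.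
    by apply: contrapT => NP; apply: Nt; left; exact: HN1.
  by move=> /(_ i t0).
rewrite /Caputo derive1E (derive_mx dC); apply/rowP => i; rewrite !mxE -mulrA.
congr (_ * _); rewrite (@near_eq_derive _ _ _ _ (fun s => c * J 1 (h i) s)).
  have [di <-] := HD i.
  by rewrite derive1E deriveMl.
near=> s; apply: CE; apply/andP; split; apply: ltW; near: s.
  exact: lt_nbhsr.
exact: lt_nbhsl.
Unshelve. all: by end_near. Qed.

End to_trajectory.

(** * Uniform continuity, saddle points, null sets and partitions *)

Section uniform_continuity.
Context {R : realType}.

(** Near-covering form of compactness, with the radius as the small parameter. *)
Lemma compact_unif_continuous (X : pseudoMetricType R) (V : normedModType R)
    (K D : set X) (f : X -> V) : compact K -> K `<=` D -> {within D, continuous f} ->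
  forall e : R, 0 < e -> exists2 d : R, 0 < d &
    forall p q, K p -> D q -> ball p d q -> `|f p - f q| < e.
Proof.
move=> cK KD cf e e0.
have /compact_near_coveringP cK' := cK.
pose Pr (d : R) (p : X) := D p -> forall q, D q -> ball p d q -> `|f p - f q| < e.
have := cK' R (0^'+) Pr _.
case.
  move=> x Kx; have /subspace_continuousP /(_ x (KD _ Kx)) := cf.
  have e20 : 0 < e / 2 by rewrite divr_gt0.
  move=> /cvgrPdist_lt /(_ _ e20); rewrite near_withinE => /nbhs_ballP[r /= r0 Hr].
  have r20 : 0 < r / 2 by rewrite divr_gt0.
  exists (ball x (r / 2), [set d : R | d < r / 2]).
    split; first exact: nbhsx_ballx.
    exact: nbhs_right_lt.
  move=> [p d] /= [xp dr] Dp q Dq pq.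
  have xq : ball x r q.
    rewrite [r]splitr; apply: ball_triangle xp _.
    by apply: le_ball pq; exact: ltW.
  have xp' : ball x r p by apply: le_ball xp; lra.
  have := Hr _ xq Dq; have := Hr _ xp' Dp => /= H1 H2.
  rewrite -(subrKA (f x)) (le_lt_trans (ler_normD _ _))//.
  by rewrite [ltRHS]splitr distrC ltrD// distrC.
move=> d0 /= d00 Hd.
exists (d0 / 2); first by rewrite divr_gt0.
move=> p q Kp Dq pq; apply: (Hd (d0 / 2)) => //.
- by rewrite /= sub0r normrN gtr0_norm ?divr_gt0//; lra.
- by rewrite divr_gt0.
- exact: KD.
Qed.

Lemma within_continuous_comp (X Y Z : topologicalType) (phi : X -> Y) (f : Y -> Z)
    (A : set X) (D : set Y) : continuous phi -> (forall x, A x -> D (phi x)) ->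
  {within D, continuous f} -> {within A, continuous (f \o phi)}.
Proof.
move=> cphi AD /subspace_continuousP cf; apply/subspace_continuousP => x Ax.
apply: (cvg_comp _ _ _ (cf _ (AD _ Ax))) => W DW.
have H1 : nbhs x (phi @^-1` (fun y => D y -> W y)) := cphi x _ DW.
change (nbhs x (fun y => A y -> W (phi y))).
by apply: filterS H1 => y H Ay; apply: H; exact: AD.
Qed.

Lemma continuous_dotv n (s : 'rV[R]_n) : continuous (dotv s).
Proof.
move=> x; have Fx : Filter (nbhs x) by exact: nbhs_filter.
apply/cvgrPdist_le => e e0.
pose K := enorm s * n%:R + 1.
have K0 : 0 < K by rewrite ltr_wpDl// mulr_ge0// enorm_ge0.
near=> y.
have xy : `|x - y| <= e / K.
  by near: y; apply: cvgr_dist_le => //; rewrite divr_gt0.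
have H z : dotv s z <= K * `|z|.
  apply: (le_trans (cauchy_schwarz _ _)).
  apply: (@le_trans _ _ (enorm s * (n%:R * `|z|))).
    by rewrite ler_wpM2l ?enorm_ge0 ?enorm_le_norm.
  by rewrite mulrA ler_wpM2r// lerDl.
rewrite -dotvBr; have xyK : K * `|x - y| <= e by rewrite mulrC -ler_pdivlMr.
rewrite ler_norml; apply/andP; split; last exact: le_trans (H _) xyK.
rewrite lerNl -dotvNr; apply: le_trans (H _) _.
by rewrite normrN.
Unshelve. all: by end_near. Qed.

End uniform_continuity.

Section saddle.
Context {R : realType}.

Lemma minval_argmin (X : Type) (A : set X) (f : X -> R) a :
  argmin A f a -> minval A f = f a.
Proof.
move=> [Aa fa]; rewrite /minval; apply: xget_unique.
  by split; [exists a|move=> _ [b Ab <-]; exact: fa].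
move=> _ [[b Ab <-] Hb]; apply/eqP; rewrite eq_le fa// andbT.
by apply: Hb; exists a.
Qed.

Lemma maxval_argmax (X : Type) (A : set X) (f : X -> R) a :
  argmax A f a -> maxval A f = f a.
Proof.
move=> [Aa fa]; rewrite /maxval; apply: xget_unique.
  by split; [exists a|move=> _ [b Ab <-]; exact: fa].
move=> _ [[b Ab <-] Hb]; apply/eqP; rewrite eq_le fa//=.
by apply: Hb; exists a.
Qed.

Lemma le_maxval (X : topologicalType) (A : set X) (f : X -> R) a :
  compact A -> {within A, continuous f} -> A a -> f a <= maxval A f.
Proof.
move=> cA cf Aa; have A0 : A !=set0 by exists a.
have [c /set_mem Ac Hc] := compact_EVT_max A0 cA cf.
rewrite (@maxval_argmax _ _ _ c); first by apply: Hc; rewrite inE.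
by split=> // b Ab; apply: Hc; rewrite inE.
Qed.

Lemma minval_le (X : topologicalType) (A : set X) (f : X -> R) a :
  compact A -> {within A, continuous f} -> A a -> minval A f <= f a.
Proof.
move=> cA cf Aa; have A0 : A !=set0 by exists a.
have [c /set_mem Ac Hc] := compact_EVT_min A0 cA cf.
rewrite (@minval_argmin _ _ _ c); first by apply: Hc; rewrite inE.
by split=> // b Ab; apply: Hc; rewrite inE.
Qed.

(** h(uj, v) <= max h(uj, .) = min max h = max min h = min h(., vj) <= h(u, vj). *)
Lemma aiming_saddle (X Y : topologicalType) (P : set X) (Q : set Y)
    (h : X -> Y -> R) uj vj u v :
  compact P -> compact Q ->
  (forall u', P u' -> {within Q, continuous (h u')}) ->
  (forall v', Q v' -> {within P, continuous (h^~ v')}) ->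
  minval P (fun u' => maxval Q (fun v' => h u' v')) =
    maxval Q (fun v' => minval P (fun u' => h u' v')) ->
  argmin P (fun u' => maxval Q (fun v' => h u' v')) uj ->
  argmax Q (fun v' => minval P (fun u' => h u' v')) vj ->
  P u -> Q v -> h uj v <= h u vj.
Proof.
move=> cP cQ hQ hP minmax muj mvj Pu Qv.
rewrite (minval_argmin muj) (maxval_argmax mvj) in minmax.
apply: (@le_trans _ _ (maxval Q (fun v' => h uj v'))).
  by apply: (@le_maxval _ Q (h uj)) => //; apply: hQ; case: muj.
rewrite minmax; apply: (@minval_le _ P (h^~ vj)) => //.
by apply: hP; case: mvj.
Qed.

End saddle.

Section patch.
Context {R : realType}.
Notation mu := (@lebesgue_measure R).

Lemma causal_patch (A : set R) (f : R -> R) :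
  measurable (A : set (measurableTypeR R)) -> causal f -> causal (f \_ A).
Proof.
move=> mA [mf f0 bf]; split=> [|s s0|t].
- by apply/(measurable_restrictT f mA); exact: measurable_funTS.
- by rewrite patchE f0//; case: ifP.
have [M HM] := bf t; exists M => s st; rewrite patchE; case: ifP => _; first exact: HM.
by rewrite normr0 (le_trans _ (HM s st)).
Qed.

(** This serves to turn an equation that holds almost everywhere on an interval
    into one that holds at every point. *)
Lemma J_patch p T (A N : set R) (f : R -> R) t : 0 < p -> causal f ->
  measurable (A : set (measurableTypeR R)) ->
  measurable (N : set (measurableTypeR R)) -> mu N = 0 ->
  (forall s, 0 <= s < T -> ~ A s -> N s) -> t <= T ->
  J p (f \_ A) t = J p f t.
Proof.
move=> p0 cf mA mN N0 AN tT; have cfA := causal_patch mA cf.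
rewrite !JE /Rintegral; congr fine.
pose F1 s := (ker p (t - s) * (f \_ A) s)%:E.
pose F2 s := (ker p (t - s) * f s)%:E.
have mF1 : measurable_fun setT F1.
  by apply/measurable_EFinP/measurable_funM; [exact: measurable_ker_sub|case: cfA].
have mF2 : measurable_fun setT F2.
  by apply/measurable_EFinP/measurable_funM; [exact: measurable_ker_sub|case: cf].
have F12 : ae_eq mu setT F1 F2.
  exists N; split => // s /= H; apply: contrapT => Ns; apply: H => _.
  rewrite /F1 /F2; have [ts|st] := leP t s.
    by rewrite ker_le0 ?subr_le0// !mul0r.
  have [s0|s0] := leP 0 s; last first.
    by rewrite patchE; case: cf => _ ->// _; case: ifP.
  rewrite patchE mem_set//; apply: contrapT => As.
  by apply/Ns/AN => //; rewrite s0 (lt_le_trans st).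
have E := @ae_eq_integral _ _ _ mu _ F2 F1 measurableT mF1 mF2 F12.
exact E.
Qed.

Lemma traj_patch n rho p T (A N : set R) z (f : R -> 'rV[R]_n) : 0 < p -> vcausal f ->
  measurable (A : set (measurableTypeR R)) ->
  measurable (N : set (measurableTypeR R)) -> mu N = 0 ->
  (forall s, 0 <= s < T -> ~ A s -> N s) ->
  vcausal (fun s => if s \in A then f s else 0) /\
  forall t, t <= T -> traj rho p z (fun s => if s \in A then f s else 0) t =
    traj rho p z f t.
Proof.
move=> p0 cf mA mN N0 AN.
have E i : (fun s => (if s \in A then f s else 0) 0 i) = (fun s => f s 0 i) \_ A.
  by apply/funext => s; rewrite patchE; case: ifP; rewrite ?mxE.
split=> [i|t tT]; first by rewrite E; exact: causal_patch.
apply/rowP => i; rewrite !trajE E; congr (_ + _ * _).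
exact: (J_patch p0 (cf i) mA mN N0 AN tT).
Qed.

End patch.

Section partition.
Context {R : realType}.

Lemma partition_mono (T : R) k tau : is_partition T k tau ->
  forall i j, (i <= j <= k)%N -> tau i <= tau j.
Proof.
move=> [_ _ Ht _] i; elim=> [|j IH] /andP[].
  by rewrite leqn0 => /eqP ->.
rewrite leq_eqVlt => /predU1P[-> //|ij] jk.
by apply: (le_trans (IH _)); [rewrite -ltnS ij ltnW|apply: ltW; exact: Ht].
Qed.

Lemma partition_find (T : R) k tau t : is_partition T k tau -> 0 <= t < T ->
  exists2 j, (j < k)%N & tau j <= t < tau j.+1.
Proof.
move=> [k0 t0 Ht tk] /andP[t0' tT].
have : exists j, (j <= k)%N && (t < tau j) by exists k; rewrite leqnn tk.
move=> ex; case: (ex_minnP ex) => -[|j] /andP[jk tj] Hmin.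
  by move: tj; rewrite t0 ltNge t0'.
exists j => //; rewrite tj andbT leNgt; apply/negP => tj'.
by have := Hmin j; rewrite tj' (ltnW jk) ltnn => /(_ isT).
Qed.

Lemma diam_ge k (tau : nat -> R) j : (j < k)%N -> tau j.+1 - tau j <= diam k tau.
Proof.
move=> jk; rewrite /diam.
by have := @le_bigmax _ _ _ 0 (fun j : 'I_k => tau j.+1 - tau j) (Ordinal jk).
Qed.

Lemma Linf_norm_le n (T B : R) (f : R -> 'rV[R]_n) : 0 <= B ->
  (forall t, 0 <= t <= T -> enorm (f t) <= B) -> (Linf_norm T f <= B%:E)%E.
Proof.
move=> B0 fB; rewrite /Linf_norm unlock; case: ifP => _; last by rewrite lee_fin.
apply/ess_supP; apply: nearW => t /=; rewrite lee_fin patchE mem_setE in_itv/=.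
by case: ifP => [/fB|_]; rewrite ?normr0// ger0_norm ?sqrtr_ge0.
Qed.

End partition.

(** * The aiming procedure *)

Section pairing.
Context {X Y : topologicalType}.

Lemma continuous_pairl (c : X) : continuous (fun y : Y => (c, y)).
Proof.
move=> y W [[A B] /= [cA yB] AB]; have Ac := nbhs_singleton cA.
change (nbhs y (fun z => W (c, z))).
by apply: filterS yB => z Bz; apply: AB.
Qed.

Lemma continuous_pairr (c : Y) : continuous (fun x : X => (x, c)).
Proof.
move=> x W [[A B] /= [xA cB] AB]; have Bc := nbhs_singleton cB.
change (nbhs x (fun z => W (z, c))).
by apply: filterS xA => z Az; apply: AB.
Qed.

End pairing.

Section game.
Context {R : realType} {n nu nv : nat}.
Variables (alpha T : R) (alpha01 : 0 < alpha < 1) (T_gt0 : 0 < T).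
Variables (P : set 'rV[R]_nu) (Q : set 'rV[R]_nv).
Variables (cptP : compact P) (cptQ : compact Q).
Variable (g : R -> 'rV[R]_n -> 'rV[R]_nu -> 'rV[R]_nv -> 'rV[R]_n).

Let dom : set (R * 'rV[R]_n * 'rV[R]_nu * 'rV[R]_nv) :=
  [set p | [/\ 0 <= p.1.1.1 <= T, P p.1.2 & Q p.2]].

Hypothesis g1 : {within dom,
  continuous (fun p : R * 'rV[R]_n * 'rV[R]_nu * 'rV[R]_nv =>
                g p.1.1.1 p.1.1.2 p.1.2 p.2)}.
Hypothesis g2 : forall r : R, 0 <= r -> exists2 lambda : R, 0 < lambda &
  forall (t : R) (x y : 'rV[R]_n) (u : 'rV[R]_nu) (v : 'rV[R]_nv),
    0 <= t <= T -> cball0 r x -> cball0 r y -> P u -> Q v ->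
    enorm (g t x u v - g t y u v) <= lambda * enorm (x - y).
Hypothesis g3 : exists2 c : R, 0 < c &
  forall (t : R) (x : 'rV[R]_n) (u : 'rV[R]_nu) (v : 'rV[R]_nv),
    0 <= t <= T -> P u -> Q v -> enorm (g t x u v) <= (1 + enorm x) * c.
Hypothesis g4 : forall (t : R) (x s : 'rV[R]_n), 0 <= t <= T ->
  minval P (fun u => maxval Q (fun v => dotv s (g t x u v))) =
  maxval Q (fun v => minval P (fun u => dotv s (g t x u v))).

Lemma saddle_step t x s uj vj u v : 0 <= t <= T ->
  argmin P (fun u' => maxval Q (fun v' => dotv s (g t x u' v'))) uj ->
  argmax Q (fun v' => minval P (fun u' => dotv s (g t x u' v'))) vj ->
  P u -> Q v -> dotv s (g t x uj v) <= dotv s (g t x u vj).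
Proof.
move=> tT muj mvj Pu Qv.
apply: (aiming_saddle (h := fun u v => dotv s (g t x u v)) cptP cptQ _ _ _ muj mvj) => //.
- move=> u' Pu'.
  have cg : {within Q, continuous (fun v' => g t x u' v')}.
    apply: (within_continuous_comp (phi := fun v' => (t, x, u', v')) _ _ g1).
      exact: continuous_pairl.
    by move=> v' Qv'; split.
  move=> v'; apply: (continuous_comp (cg v')); exact: continuous_dotv.
- move=> v' Qv'.
  have cg : {within P, continuous (fun u' => g t x u' v')}.
    apply: (within_continuous_comp (phi := fun u' => (t, x, u', v')) _ _ g1).
      move=> u'; apply: (continuous_comp (f := fun u' => (t, x, u')) (g := fun p => (p, v'))).
        exact: continuous_pairl.
      exact: continuous_pairr.
    by move=> u' Pu'; split.
  move=> u'; apply: (continuous_comp (cg u')); exact: continuous_dotv.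
- exact: g4.
Qed.

Lemma g_unif_continuous (r e : R) : 0 < e -> exists2 d : R, 0 < d &
  forall t t' x x' u v, 0 <= t <= T -> 0 <= t' <= T -> P u -> Q v ->
    enorm x <= r -> `|t - t'| < d -> enorm (x - x') < d ->
    enorm (g t x u v - g t' x' u v) <= e.
Proof.
move=> e0.
pose B := [set y : 'rV[R]_n | forall i, `[- r, r]%classic (y ord0 i)].
have cB : compact B.
  apply: (@rV_compact R n (fun _ => `[- r, r]%classic)) => i.
  exact: segment_compact.
pose K := ((`[0, T]%classic `*` B) `*` P) `*` Q.
have cK : compact K.
  do 2 (apply: compact_setX => //); apply: compact_setX => //.
  exact: segment_compact.
have Kdom : K `<=` dom.
  by move=> p [[[tT _] Pp] Qp]; split=> //; move: tT; rewrite /= in_itv.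
have e1 : 0 < e / n.+1%:R by rewrite divr_gt0.
have [d d0 Hd] := compact_unif_continuous cK Kdom g1 e1.
exists d => // t t' x x' u v tT t'T Pu Qv xr tt' xx'.
have : `|g t x u v - g t' x' u v| < e / n.+1%:R.
  apply: (Hd (t, x, u, v) (t', x', u, v)).
  - split=> //; split=> //; split=> /=; first by rewrite in_itv.
    move=> i; rewrite /= in_itv/= -ler_norml.
    by apply: le_trans xr; exact: coord_le_enorm.
  - by split.
  - split; last exact: ballxx.
    split; last exact: ballxx.
    split=> //=.
    rewrite mx_norm_ball /ball_ /=; apply: le_lt_trans xx'.
    exact: norm_le_enorm.
move=> /ltW H; apply: (le_trans (enorm_le_norm _)).
apply: (@le_trans _ _ (n%:R * (e / n.+1%:R))); first by rewrite ler_wpM2l.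
by rewrite mulrCA ler_piMr ?(ltW e0)// ler_pdivrMr// mul1r ler_nat.
Qed.

(** By the growth condition <z, g> <= |z| (1 + |z|) c <= 2 c |z|^2 + c. *)
Lemma motion_bounded (R0 : R) : exists2 R1 : R, 0 <= R1 &
  forall z0 u v f, vcausal f -> enorm z0 <= R0 ->
    let z := traj (volterra_coef alpha) alpha z0 f in
    (forall s, 0 <= s < T -> P (u s) /\ Q (v s)) ->
    (forall s, 0 <= s < T -> f s = 0 \/ f s = g s (z s) (u s) (v s)) ->
    forall t, 0 <= t <= T -> enorm (z t) <= R1.
Proof.
have [c c0 Hc] := g3.
have rho0 : 0 <= volterra_coef alpha by rewrite ltW// volterra_coef_gt0.
have l0 : 0 <= 2 * c by rewrite mulr_ge0// ltW.
have [C C0 HC] := traj_bound (n := n) alpha01 rho0 l0 T_gt0.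
pose S := C * (R0 ^+ 2 + c).
exists (Num.sqrt S); first exact: sqrtr_ge0.
move=> z0 u v f cf z0R z Huv Hf t tT.
have S0 : 0 <= S by rewrite mulr_ge0 ?addr_ge0 ?sqr_ge0 ?ltW.
rewrite -(ler_pXn2r (ltn0Sn 1)) ?nnegrE ?enorm_ge0 ?sqrtr_ge0// [leRHS]sqr_sqrtr//.
apply: (le_trans (HC z0 f c cf (ltW c0) _ t tT)).
  move=> s sT; rewrite -/(z s); set y := enorm (z s).
  have y0 : 0 <= y by exact: enorm_ge0.
  have [->|->] := Hf s sT.
    rewrite dotvx0; apply: addr_ge0; last exact: ltW.
    by apply: mulr_ge0 => //; exact: sqr_ge0.
  apply: (le_trans (cauchy_schwarz _ _)); rewrite -/y.
  have [Pu Qv] := Huv s sT.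
  have : enorm (g s (z s) (u s) (v s)) <= (1 + y) * c.
    by apply: Hc => //; case/andP: sT => -> /ltW.
  move=> H; apply: (@le_trans _ _ (y * ((1 + y) * c))); first by rewrite ler_wpM2l.
  have : 0 <= c * ((y - 1 / 2) ^+ 2 + 3 / 4).
    by rewrite mulr_ge0 ?(ltW c0)// addr_ge0 ?sqr_ge0.
  lra.
rewrite /S ler_wpM2l ?(ltW C0)// lerD2r ler_sqr ?nnegrE ?enorm_ge0//.
by rewrite (le_trans (enorm_ge0 z0)).
Qed.


(** <s, F> is split into its value frozen at the node, which is nonpositive by
    the saddle point property, the errors of freezing s and the two velocities,
    and the Lipschitz term. *)
Lemma aiming_estimate (R1 M lam eta e : R) t tj (x y xj yj : 'rV[R]_n) uj vj u v :
  0 <= tj <= T -> P u -> Q v ->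
  argmin P (fun u' => maxval Q (fun v' => dotv (xj - yj) (g tj xj u' v'))) uj ->
  argmax Q (fun v' => minval P (fun u' => dotv (xj - yj) (g tj xj u' v'))) vj ->
  enorm (x - y) <= 2 * R1 -> 0 <= M ->
  (forall a b, P a -> Q b -> enorm (g tj xj a b) <= M) ->
  (forall a b, P a -> Q b -> enorm (g tj xj a b - g t x a b) <= e) ->
  enorm (g t x u vj - g t y u vj) <= lam * enorm (x - y) ->
  enorm (x - y - (xj - yj)) <= eta ->
  dotv (x - y) (g t x uj v - g t y u vj) <=
    lam * enorm (x - y) ^+ 2 + (2 * M * eta + 4 * R1 * e).
Proof.
move=> tjT Pu Qv muj mvj xyR M0 gM ge glip sj.
have Puj : P uj by case: muj.
have Qvj : Q vj by case: mvj.
set s := x - y in xyR glip sj *; set sj0 := xj - yj in muj mvj sj *.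
have -> : dotv s (g t x uj v - g t y u vj) =
    dotv sj0 (g tj xj uj v - g tj xj u vj) +
    dotv (s - sj0) (g tj xj uj v - g tj xj u vj) +
    dotv s (g t x uj v - g tj xj uj v) + dotv s (g tj xj u vj - g t x u vj) +
    dotv s (g t x u vj - g t y u vj).
  by rewrite !(dotvBl, dotvBr); ring.
have B1 : dotv sj0 (g tj xj uj v - g tj xj u vj) <= 0.
  by rewrite dotvBr subr_le0; exact: saddle_step.
have CS (a b : 'rV[R]_n) (ka kb : R) : enorm a <= ka -> enorm b <= kb ->
    dotv a b <= ka * kb.
  move=> Ha Hb; apply: (le_trans (cauchy_schwarz a b)).
  by rewrite ler_pM ?enorm_ge0.
have B2 : dotv (s - sj0) (g tj xj uj v - g tj xj u vj) <= eta * (2 * M).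
  apply: CS => //; apply: (le_trans (enormD _ _)); rewrite enormN.
  by have := gM _ _ Puj Qv; have := gM _ _ Pu Qvj; lra.
have B3 : dotv s (g t x uj v - g tj xj uj v) <= 2 * R1 * e.
  by apply: CS => //; rewrite enormB; exact: ge.
have B4 : dotv s (g tj xj u vj - g t x u vj) <= 2 * R1 * e.
  by apply: CS => //; exact: ge.
have B5 : dotv s (g t x u vj - g t y u vj) <= enorm s * (lam * enorm s).
  by apply: CS.
lra.
Qed.

(** The theorem for solutions of the Volterra equation whose forcing is
    everywhere, not just almost everywhere, either the velocity or 0. At the points
    where both forcings are 0 the estimate of <s, F> is trivial. *)
Lemma tracking (R0 eps : R) : 0 < R0 -> 0 < eps -> exists K delta : R,
  [/\ 0 < K, 0 < delta &
  forall (x0 y0 : 'rV[R]_n) (k : nat) (tau : nat -> R)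
    (u ut : R -> 'rV[R]_nu) (v vt : R -> 'rV[R]_nv) (fx fy : R -> 'rV[R]_n),
    let x := traj (volterra_coef alpha) alpha x0 fx in
    let y := traj (volterra_coef alpha) alpha y0 fy in
    enorm x0 <= R0 -> enorm y0 <= R0 ->
    is_partition T k tau -> diam k tau <= delta ->
    (forall s, 0 <= s < T -> [/\ P (u s), P (ut s), Q (v s) & Q (vt s)]) ->
    vcausal fx -> vcausal fy -> (forall s, ~~ (0 <= s < T) -> fx s = 0 /\ fy s = 0) ->
    (forall s, 0 <= s < T -> (fx s = 0 /\ fy s = 0) \/
      (fx s = g s (x s) (u s) (v s) /\ fy s = g s (y s) (ut s) (vt s))) ->
    mutual_aiming P Q g k tau x y u vt ->
    forall t, 0 <= t <= T -> enorm (x t - y t) <= eps + K * enorm (x0 - y0)].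
Proof.
move=> R0_gt0 eps0.
have [a0 a1] : 0 < alpha /\ alpha < 1 by case/andP: alpha01.
have aP : 0 < alpha <= 1 by rewrite a0 ltW.
have rho0 : 0 <= volterra_coef alpha by rewrite ltW// volterra_coef_gt0.
have [R1 R1_ge0 HR1] := motion_bounded R0.
have [c c0 Hc] := g3.
have [lam lam0 Hlam] := g2 R1_ge0.
have [C C0 HC] := traj_bound (n := n) alpha01 rho0 (ltW lam0) T_gt0.
(* C e' = eps^2; M bounds the velocities and H is the Hoelder constant of the
   motions. *)
pose e' := eps ^+ 2 / C.
have e'0 : 0 < e' by rewrite divr_gt0// exprn_gt0.
pose M := (1 + R1) * c.
have M0 : 0 <= M by rewrite mulr_ge0 ?addr_ge0 ?(ltW c0).
pose H := n%:R * (volterra_coef alpha * (2 * M / alpha)).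
have H0 : 0 <= H.
  apply: mulr_ge0 => //; apply: mulr_ge0 => //.
  by apply: divr_ge0; [apply: mulr_ge0|exact: ltW].
pose e1 := e' / (8 * (R1 + 1)).
have R11 : 0 < R1 + 1 by rewrite ltr_wpDl.
have e10 : 0 < e1 by rewrite divr_gt0// mulr_gt0.
have [d d0 Hd] := g_unif_continuous R1 e10.
have M1 : 0 < M + 1 by rewrite ltr_wpDl.
(* m is the admissible oscillation of a motion over one step: below the radius
   d of uniform continuity, and so small that its part of the error is at most
   e' / 2. *)
pose m := Num.min (d / 2) (e' / (8 * (M + 1))).
have m0 : 0 < m by rewrite lt_min !divr_gt0// mulr_gt0.
have H1 : 0 < H + 1 by rewrite ltr_wpDl.
pose delta := Num.min (d / 2) ((m / (H + 1)) `^ alpha^-1).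
have delta0 : 0 < delta by rewrite lt_min divr_gt0// powR_gt0// divr_gt0.
have Hdelta r : 0 <= r -> r <= delta -> H * r `^ alpha <= m.
  move=> r0 rd; apply: (@le_trans _ _ (H * (m / (H + 1)))).
    rewrite ler_wpM2l//; have mH0 : 0 <= m / (H + 1) by rewrite divr_ge0// ltW.
    have -> : m / (H + 1) = ((m / (H + 1)) `^ alpha^-1) `^ alpha.
      by rewrite -powRrM mulVf ?lt0r_neq0// powRr1.
    rewrite ge0_ler_powR// ?nnegrE ?(ltW a0) ?powR_ge0//.
    by apply: (le_trans rd); rewrite ge_min lexx orbT.
  rewrite mulrCA ler_piMr ?(ltW m0)// ler_pdivrMr// mul1r; lra.
have sC0 : 0 < Num.sqrt C by rewrite sqrtr_gt0.
exists (Num.sqrt C), delta; split=> // x0 y0 k tau u ut v vt fx fy x y x0R y0R.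
move=> part diamd Hrel cfx cfy Hout Hf aim t tT.
have [k0 tau0 tauS tauk] := part.
have Hx : forall s, 0 <= s <= T -> enorm (x s) <= R1.
  apply: (HR1 x0 u v fx cfx x0R).
    by move=> s sT; have [] := Hrel s sT.
  by move=> s sT; have [[-> _]|[-> _]] := Hf s sT; [left|right].
have Hy : forall s, 0 <= s <= T -> enorm (y s) <= R1.
  apply: (HR1 y0 ut vt fy cfy y0R).
    by move=> s sT; have [] := Hrel s sT.
  by move=> s sT; have [[_ ->]|[_ ->]] := Hf s sT; [left|right].
have E0 := @enorm0 R n.
have gM s z a b : 0 <= s <= T -> enorm z <= R1 -> P a -> Q b -> enorm (g s z a b) <= M.
  move=> sT zR Pa Qb; apply: (le_trans (Hc _ _ _ _ sT Pa Qb)).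
  by rewrite ler_wpM2r ?(ltW c0)// lerD2l.
have fxM s : enorm (fx s) <= M.
  have [sT|/Hout[-> _]] := boolP (0 <= s < T); last by rewrite E0.
  have sT' : 0 <= s <= T by case/andP: sT => -> /ltW.
  have [Pu Put Qv Qvt] := Hrel s sT.
  have [[-> _]|[-> _]] := Hf s sT; first by rewrite E0.
  by apply: gM => //; exact: Hx.
have fyM s : enorm (fy s) <= M.
  have [sT|/Hout[_ ->]] := boolP (0 <= s < T); last by rewrite E0.
  have sT' : 0 <= s <= T by case/andP: sT => -> /ltW.
  have [Pu Put Qv Qvt] := Hrel s sT.
  have [[_ ->]|[_ ->]] := Hf s sT; first by rewrite E0.
  by apply: gM => //; exact: Hy.
have cf : vcausal (fun s => fx s - fy s).
  move=> i; have -> : (fun s => (fx s - fy s) 0 i) = (fun s => fx s 0 i - fy s 0 i).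
    by apply/funext => s; rewrite !mxE.
  exact: causalB.
have sE s : x s - y s = traj (volterra_coef alpha) alpha (x0 - y0) (fun s => fx s - fy s) s.
  exact: trajB.
have key s : 0 <= s < T -> dotv (x s - y s) (fx s - fy s) <=
    lam * enorm (x s - y s) ^+ 2 + e'.
  move=> sT; have sT' : 0 <= s <= T by case/andP: sT => -> /ltW.
  have [[-> ->]|[-> ->]] := Hf s sT.
    rewrite subrr dotvx0 addr_ge0 ?(ltW e'0)//.
    by apply: mulr_ge0; [exact: ltW|exact: sqr_ge0].
  have [Pu Put Qv Qvt] := Hrel s sT.
  have [j jk /andP[js sj]] := partition_find part sT.
  have tj0 : 0 <= tau j.
    by rewrite -[leLHS]tau0; apply: (partition_mono part); rewrite leq0n ltnW.
  have tjT : tau j <= T by rewrite (le_trans js)//; case/andP: sT'.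
  have tjT' : 0 <= tau j <= T by rewrite tj0.
  have sd : s - tau j <= delta.
    by apply: le_trans diamd; apply: le_trans (diam_ge tau jk); rewrite lerD2r ltW.
  have sd0 : 0 <= s - tau j by rewrite subr_ge0.
  have [uj [vj [muj mvj Huv]]] := aim j jk.
  have [us vts] : u s = uj /\ vt s = vj by apply: Huv; rewrite js.
  have hx : enorm (x s - x (tau j)) <= m.
    apply: le_trans (Hdelta _ sd0 sd).
    exact: (traj_holder x0 aP rho0 cfx js (fun r _ => fxM r)).
  have hy : enorm (y s - y (tau j)) <= m.
    apply: le_trans (Hdelta _ sd0 sd).
    exact: (traj_holder y0 aP rho0 cfy js (fun r _ => fyM r)).
  have md : m < d.
    have : m <= d / 2 by rewrite ge_min lexx.
    by move: d0; lra.
  have dd : delta < d.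
    have : delta <= d / 2 by rewrite ge_min lexx.
    by move: d0; lra.
  rewrite us vts.
  have xy2 : enorm (x s - y s) <= 2 * R1.
    apply: (le_trans (enormD _ _)); rewrite enormN.
    by have := Hx s sT'; have := Hy s sT'; lra.
  have eta2 : enorm (x s - y s - (x (tau j) - y (tau j))) <= 2 * m.
    have -> : x s - y s - (x (tau j) - y (tau j)) =
        (x s - x (tau j)) + - (y s - y (tau j)).
      by apply/rowP => i; rewrite !mxE; ring.
    by apply: (le_trans (enormD _ _)); rewrite enormN; lra.
  have := @aiming_estimate R1 M lam (2 * m) e1 s (tau j) (x s) (y s) (x (tau j))
    (y (tau j)) uj vj (ut s) (v s) tjT' Put Qv muj mvj xy2 M0.
  move=> /(_ (fun a b => gM _ _ a b tjT' (Hx _ tjT'))) AE.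
  apply: (le_trans (AE _ _ eta2)).
  - move=> a b Pa Qb; apply: Hd => //; first exact: Hx.
      by rewrite distrC ger0_norm// (le_lt_trans sd).
    by rewrite enormB (le_lt_trans hx).
  - apply: Hlam => //; first exact: Hx.
      exact: Hy.
    by case: mvj.
  - rewrite lerD2l.
    have K1 : 2 * M * (2 * m) <= e' / 2.
      have : m <= e' / (8 * (M + 1)) by rewrite ge_min lexx orbT.
      move=> H2; apply: (@le_trans _ _ (4 * M * (e' / (8 * (M + 1))))).
        have -> : 2 * M * (2 * m) = 4 * M * m by ring.
        by rewrite ler_wpM2l// mulr_ge0.
      have -> : 4 * M * (e' / (8 * (M + 1))) = (e' / 2) * (M / (M + 1)).
        by field; rewrite gt_eqF.
      apply: ler_piMr; first by apply: divr_ge0 => //; exact: ltW.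
      by rewrite ler_pdivrMr// mul1r lerDl.
    have K2 : 4 * R1 * e1 <= e' / 2.
      have -> : 4 * R1 * e1 = (e' / 2) * (R1 / (R1 + 1)).
        by rewrite /e1; field; rewrite gt_eqF.
      apply: ler_piMr; first by apply: divr_ge0 => //; exact: ltW.
      by rewrite ler_pdivrMr// mul1r lerDl.
    lra.
have := HC (x0 - y0) (fun s => fx s - fy s) e' cf (ltW e'0) _ t tT.
rewrite -sE => F.
have {}F : enorm (x t - y t) ^+ 2 <= C * (enorm (x0 - y0) ^+ 2 + e').
  by apply: F => s sT; rewrite -sE; exact: key.
have n0 : 0 <= enorm (x0 - y0) by exact: enorm_ge0.
rewrite -(ler_pXn2r (ltn0Sn 1)) ?nnegrE ?enorm_ge0//; last first.
  by rewrite addr_ge0 ?(ltW eps0)// mulr_ge0// ltW.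
apply: (le_trans F).
have -> : C * (enorm (x0 - y0) ^+ 2 + e') =
    Num.sqrt C ^+ 2 * enorm (x0 - y0) ^+ 2 + eps ^+ 2.
  rewrite sqr_sqrtr ?(ltW C0)// mulrDr /e'; congr (_ + _); field.
  by rewrite gt_eqF.
have : 0 <= 2 * eps * (Num.sqrt C * enorm (x0 - y0)).
  by rewrite mulr_ge0 ?mulr_ge0 ?(ltW eps0)// ltW.
lra.
Qed.

End game.

Unset Implicit Arguments.

Theorem theorem5p1 (R : realType) (n nu nv : nat)
  (n_gt0 : (0 < n)%N) (nu_gt0 : (0 < nu)%N) (nv_gt0 : (0 < nv)%N)
  (alpha T : R) (alpha01 : 0 < alpha < 1) (T_gt0 : 0 < T)
  (P : set 'rV[R]_nu) (Q : set 'rV[R]_nv)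
  (cptP : compact P) (cptQ : compact Q)
  (g : R -> 'rV[R]_n -> 'rV[R]_nu -> 'rV[R]_nv -> 'rV[R]_n)
  (g1 : {within [set p : R * 'rV[R]_n * 'rV[R]_nu * 'rV[R]_nv |
             [/\ 0 <= p.1.1.1 <= T, P p.1.2 & Q p.2]],
          continuous (fun p : R * 'rV[R]_n * 'rV[R]_nu * 'rV[R]_nv =>
                        g p.1.1.1 p.1.1.2 p.1.2 p.2)})
  (g2 : forall r : R, 0 <= r -> exists2 lambda : R, 0 < lambda &
          forall (t : R) (x y : 'rV[R]_n) (u : 'rV[R]_nu) (v : 'rV[R]_nv),
            0 <= t <= T -> cball0 r x -> cball0 r y ->
            P u -> Q v ->
            enorm (g t x u v - g t y u v) <= lambda * enorm (x - y))
  (g3 : exists2 c : R, 0 < c &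
          forall (t : R) (x : 'rV[R]_n) (u : 'rV[R]_nu) (v : 'rV[R]_nv),
            0 <= t <= T -> P u -> Q v ->
            enorm (g t x u v) <= (1 + enorm x) * c)
  (g4 : forall (t : R) (x s : 'rV[R]_n), 0 <= t <= T ->
          minval P (fun u => maxval Q (fun v => dotv s (g t x u v))) =
          maxval Q (fun v => minval P (fun u => dotv s (g t x u v)))) :
  forall R0 eps : R, 0 < R0 -> 0 < eps ->
  exists K delta : R, [/\ 0 < K, 0 < delta &
    forall (x0 y0 : 'rV[R]_n) (k : nat) (tau : nat -> R)
      (u ut : R -> 'rV[R]_nu) (v vt : R -> 'rV[R]_nv) (x y : R -> 'rV[R]_n),
      cball0 R0 x0 -> cball0 R0 y0 ->
      is_partition T k tau -> diam k tau <= delta ->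
      realizations T Q v -> realizations T P ut ->
      realizations T P u -> realizations T Q vt ->
      is_motion alpha T g x0 u v x -> is_motion alpha T g y0 ut vt y ->
      mutual_aiming P Q g k tau x y u vt ->
      (Linf_norm T (fun t => (x t - y t)%R) <= (eps + K * enorm (x0 - y0))%R%:E)%E].
Proof.
move=> R0 eps R0_gt0 eps_gt0.
have [K [delta [K0 delta0 H]]] :=
  tracking alpha01 T_gt0 cptP cptQ g1 g2 g3 g4 R0_gt0 eps_gt0.
exists K, delta; split=> // x0 y0 k tau u ut v vt x y x0R y0R part diamd.
move=> [_ Qv] [_ Put] [_ Pu] [_ Qvt] mx my aim.
have [fx [Nx [cfx mNx Nx0 xE fxE]]] := motion_traj alpha01 T_gt0 mx.
have [fy [Ny [cfy mNy Ny0 yE fyE]]] := motion_traj alpha01 T_gt0 my.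
(* The velocity equation is known only on the open interval. *)
pose N := Nx `|` Ny `|` [set 0].
have mN : measurable (N : set (measurableTypeR R)).
  by apply: measurableU; [exact: measurableU|exact: measurable_set1].
have N0 : lebesgue_measure N = 0%E.
  apply/negligibleP => //; apply: negligibleU; last first.
    by apply/negligibleP; [exact: measurable_set1|exact: lebesgue_measure_set1].
  by apply: negligibleU; apply/negligibleP.
pose A := `[0, T[%classic `\` N.
have mA : measurable (A : set (measurableTypeR R)).
  by apply: measurableD => //; exact: measurable_itv.
have AN s : 0 <= s < T -> ~ A s -> N s.
  by move=> sT As; apply: contrapT => Ns; apply: As; split=> //=; rewrite in_itv.
have a0 : 0 < alpha by case/andP: alpha01.
have [cfx' xP] := traj_patch (volterra_coef alpha) x0 a0 cfx mA mN N0 AN.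
have [cfy' yP] := traj_patch (volterra_coef alpha) y0 a0 cfy mA mN N0 AN.
set fx' := (fun s => if s \in A then fx s else 0) in cfx' xP.
set fy' := (fun s => if s \in A then fy s else 0) in cfy' yP.
have xE' t : 0 <= t <= T -> x t = traj (volterra_coef alpha) alpha x0 fx' t.
  by move=> tT; rewrite xP ?xE//; case/andP: tT.
have yE' t : 0 <= t <= T -> y t = traj (volterra_coef alpha) alpha y0 fy' t.
  by move=> tT; rewrite yP ?yE//; case/andP: tT.
apply: Linf_norm_le; first by rewrite addr_ge0 ?mulr_ge0 ?enorm_ge0// ltW.
move=> t tT; rewrite xE'// yE'//.
apply: (H x0 y0 k tau u ut v vt fx' fy') => //.
- by move=> s sT; split; [exact: Pu|exact: Put|exact: Qv|exact: Qvt].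
- move=> s sT; rewrite /fx' /fy' memNset//= => -[/=]; rewrite in_itv/= => sT' _.
  by rewrite sT' in sT.
- move=> s sT; have sT' : 0 <= s <= T by case/andP: sT => -> /ltW.
  rewrite -xE'// -yE'// /fx' /fy'; case: ifPn => [|_]; last by left.
  rewrite inE => -[_ Ns]; right.
  have s0 : 0 < s < T.
    case/andP: sT => s0 ->; rewrite andbT lt_neqAle s0 andbT.
    by apply/eqP => s00; apply: Ns; right.
  by split; [apply: fxE|apply: fyE] => // NN; apply: Ns; left; [left|right].
move=> j jk; have tjT : 0 <= tau j <= T.
  have [_ tau0 _ tauk] := part.
  apply/andP; split; [rewrite -[leLHS]tau0|rewrite -[leRHS]tauk];
    apply: (partition_mono part); first by rewrite leq0n ltnW.
  by rewrite leqnn ltnW.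
by rewrite -xE'// -yE'//; exact: aim.
Qed.
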